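(* Let $\overline{\mathbb D}=\{i\}$ be a one-state set. For every $\varepsilon\in(0,1]$ let $(\eta_{\varepsilon,n},\kappa_{\varepsilon,n})_{n\ge 0}$ be a Markov renewal process on $\mathbb X\times[0,\infty)$, and let $v_{\varepsilon,i}\in[1,\infty)$ be a normalisation function. Assume: (A) $F_{\varepsilon,r}(0)<1$ for all $r\in\mathbb X$, $\varepsilon\in(0,1]$. (B) For every $j\in\mathbb X$, either $p_{\varepsilon,ij}>0$ for all $\varepsilon\in(0,1]$ or $p_{\varepsilon,ij}=0$ for all $\varepsilon\in(0,1]$; and there is a chain of states $i=j_0,j_1,\dots,j_n$ with $j_1,\dots,j_{n-1}\in\overline{\mathbb D}$, $j_n\in\mathbb D$ and $\prod_{l=1}^n p_{1,j_{l-1}j_l}>0$. (C) $p_{\varepsilon,ij}\to p_{0,ij}$ as $\varepsilon\to0$, for $j\in\mathbb X$. (D) For $j\in\mathbb Y_{1,i}$, $F_{\varepsilon,ij}(\cdot\, v_{\varepsilon,i})\Rightarrow F_{0,ij}(\cdot)$ as $\varepsilon\to0$, where $F_{0,ij}$ is a proper distribution function with $F_{0,ij}(0)<1$; and $v_{\varepsilon,i}\to v_{0,i}\in[1,\infty]$. (E) For $j\in\mathbb Y_{1,i}$, $e_{\varepsilon,ij}<\infty$ for all $\varepsilon\in(0,1]$, and $e_{\varepsilon,ij}/v_{\varepsilon,i}\to e_{0,ij}=\int_0^\infty t\,F_{0,ij}(dt)<\infty$ as $\varepsilon\to0$. ($\tilde{\rm C}$) $\tilde p_{\varepsilon,ij}=\mathrm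 I(j\ne i)\,\dfrac{p_{\varepsilon,ij}}{1-p_{\varepsilon,ii}}\to\tilde p_{0,ij}\in[0,1]$ as $\varepsilon\to0$, for $j\in\mathbb X$. Put $\tilde v_{\varepsilon,i}=(1-p_{\varepsilon,ii})^{-1}v_{\varepsilon,i}$. Then, for every $j\in\mathbb D$, $$G_{\varepsilon,\mathbb D,ij}(\cdot\,\tilde v_{\varepsilon,i})\Rightarrow G_{0,\mathbb D,ij}(\cdot)=\tilde F_{0,ij}(\cdot)\,\tilde p_{0,ij}\quad\text{as }\varepsilon\to0,$$ where, for $j\in\mathbb Y_{1,i}\setminus\{i\}$, $\tilde F_{0,ij}$ is the distribution function with Laplace transform $$\tilde\phi_{0,ij}(s)=\begin{cases}\phi_{0,ij}(s), & i\notin\mathbb Y_{1,i},\\[1mm] \dfrac{(1-p_{0,ii})\,\phi_{0,ij}((1-p_{0,ii})s)}{1-p_{0,ii}\,\phi_{0,ii}((1-p_{0,ii})s)}, & i\in\mathbb Y_{1,i},\ p_{0,ii}<1,\\[3mm] \dfrac1{1+e_{0,ii}s}, & p_{0,ii}=1,\end{cases}\qquad s\ge0$$ (and $G_{0,\mathbb D,ij}\equiv0$ if $j\notin\mathbb Y_{1,i}$).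
   Context: $\mathbb X=\{1,\dots,M\}$ with $M\ge2$; $\mathbb D$ is a nonempty proper subset of $\mathbb X$ and $\overline{\mathbb D}=\mathbb X\setminus\mathbb D$. For each $\varepsilon\in(0,1]$, a Markov renewal process $(\eta_{\varepsilon,n},\kappa_{\varepsilon,n})_{n\ge0}$ is a homogeneous Markov chain on $\mathbb X\times[0,\infty)$ whose transition probabilities $Q_{\varepsilon,ij}(t)=\mathsf P\{\eta_{\varepsilon,1}=j,\kappa_{\varepsilon,1}\le t\mid\eta_{\varepsilon,0}=i,\kappa_{\varepsilon,0}=s\}$ do not depend on $s$. Notation: $p_{\varepsilon,ij}=Q_{\varepsilon,ij}(\infty)$; $F_{\varepsilon,i}(t)=\sum_{j}Q_{\varepsilon,ij}(t)$; $F_{\varepsilon,ij}(t)=Q_{\varepsilon,ij}(t)/p_{\varepsilon,ij}$ if $p_{\varepsilon,ij}>0$; $e_{\varepsilon,ij}=\int_0^\infty tF_{\varepsilon,ij}(dt)$; $\mathbb Y_{1,i}=\{j\in\mathbb X:p_{1,ij}>0\}$; $\phi_{0,ij}(s)=\int_0^\infty e^{-st}F_{0,ij}(dt)$. $\mathrm I(\cdot)$ denotes an indicator. Hitting times: $\nu_{\varepsilon,\mathbb D}=\min(n\ge1:\eta_{\varepsilon,n}\in\mathbb D)$, $\tau_{\varepsilon,\mathbb D}=\sum_{n=1}^{\nu_{\varepsilon,\mathbb D}}\kappa_{\varepsilon,n}$, and $G_{\varepsilon,\mathbb D,ij}(t)=\mathsf P\{\tau_{\varepsilon,\mathbb D}\le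 t,\ \eta_{\varepsilon,\nu_{\varepsilon,\mathbb D}}=j\mid\eta_{\varepsilon,0}=i\}$, $t\ge0$, $j\in\mathbb D$. For possibly improper distribution functions on $[0,\infty)$, $G_\varepsilon(\cdot\,u_\varepsilon)\Rightarrow G_0(\cdot)$ means $G_\varepsilon(tu_\varepsilon)\to G_0(t)$ at all continuity points $t$ of $G_0$ together with convergence of total masses $G_\varepsilon(\infty)\to G_0(\infty)$; equivalently, pointwise convergence of the Laplace transforms for all $s\ge0$. The limit $\varepsilon\to0$ is through $\varepsilon>0$. *)

(* Defs.v *)
From HB Require Import structures.
From mathcomp Require Import all_boot all_order all_algebra.
From mathcomp Require Import all_classical all_reals all_analysis.

Set Implicit Arguments.
Unset Strict Implicit.
Unset Printing Implicit Defensive.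

Import Order.TTheory GRing.Theory Num.Theory.
Import numFieldNormedType.Exports.

Local Open Scope classical_set_scope.
Local Open Scope ring_scope.

(* Distributions on [0, +oo[, possibly improper, are measures on R that do
   not charge ]-oo, 0[; as functions, their distribution functions are thus
   defined on all of R and vanish on ]-oo, 0[. *)
Section distributions.
Context {R : realType}.
Implicit Type mu : {measure set (measurableTypeR R) -> \bar R}.

Definition on_half_line mu : Prop := mu `]-oo, 0[%classic = 0%E.

Definition dist_fun mu (t : R) : R := fine (mu `]-oo, t]%classic).

Definition total_mass mu : R := fine (mu setT).

Definition mean mu : \bar R := (\int[mu]_(t in `[0%R, +oo[) t%:E)%E.

Definition laplace mu (s : R) : R :=
  fine (\int[mu]_(t in `[0%R, +oo[) (expR (- s * t))%:E)%E.

Lemma inv_total_mass_ge0 mu : 0 <= (total_mass mu)^-1.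
Proof. by rewrite invr_ge0 /total_mass fine_ge0. Qed.

(* The division of mu by its total mass (only used when the latter is > 0). *)
Definition normalized mu : {measure set (measurableTypeR R) -> \bar R} :=
  mscale (NngNum (inv_total_mass_ge0 mu)) mu.

(* G_e(. u_e) => G_0 as e tends to 0 through e > 0.  A continuity point is a
   continuity point on R: 0 is one iff G_0 has no atom at 0. *)
Definition weak_cvg (G : R -> R -> R) (u : R -> R) (G0 : R -> R) : Prop :=
  (forall t, {for t, continuous G0} -> G e (t * u e) @[e --> 0^'+] --> G0 t) /\
  lim (G e t @[t --> +oo]) @[e --> 0^'+] --> lim (G0 t @[t --> +oo]).

End distributions.

Section markov_renewal.
Context {R : realType} {M : nat}.

(* Q r j is the measure with distribution function Q_{rj}(.). *)
Let kernelT := 'I_M -> 'I_M -> {measure set (measurableTypeR R) -> \bar R}.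

Definition is_semi_markov_kernel (Q : kernelT) : Prop :=
  (forall r j, on_half_line (Q r j)) /\
  (forall r, (\sum_(j < M) Q r j setT = 1)%E).

Definition trans_prob (Q : kernelT) (r j : 'I_M) : R := total_mass (Q r j).

Definition sojourn_df (Q : kernelT) (r : 'I_M) (t : R) : R :=
  \sum_(j < M) dist_fun (Q r j) t.

Definition cond_sojourn (Q : kernelT) (r j : 'I_M) :
    {measure set (measurableTypeR R) -> \bar R} := normalized (Q r j).

Section process.
Context {d : measure_display} {Omega : measurableType d}.
Variables (P : probability Omega R).
Variables (eta : nat -> Omega -> 'I_M) (kappa : nat -> Omega -> R).

(* The sigma-algebra generated by (eta_k, kappa_k), k <= n. *)
Definition history (n : nat) : set (set Omega) :=
  <<s [set A | exists2 k, (k <= n)%N &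
         (exists j, A = [set w | eta k w = j]) \/
         (exists2 B : set (measurableTypeR R),
             measurable B & A = kappa k @^-1` B)] >>.

(* The last clause says that
   P(eta_{n+1} = j, kappa_{n+1} <= t | history n) = Q_{eta_n, j}(t) a.s.;
   it is the integrated form of this identity, on each event eta_n = r. *)
Definition is_markov_renewal (Q : kernelT) : Prop :=
  [/\ is_semi_markov_kernel Q,
      forall n j, measurable [set w | eta n w = j],
      forall n, measurable_fun setT (kappa n : Omega -> measurableTypeR R),
      forall n w, 0 <= kappa n w
    & forall n A r j t, history n A ->
        P (A `&` [set w | eta n w = r] `&`
           [set w | eta n.+1 w = j /\ kappa n.+1 w <= t]) =
        (P (A `&` [set w | eta n w = r]) * Q r j `]-oo, t]%classic)%E].

Variable D : {set 'I_M}.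

(* None stands for nu = +oo. *)
Definition hit_index (w : Omega) : option nat :=
  match pselect (exists n, (0 < n)%N && (eta n w \in D)) with
  | left h => Some (ex_minn h)
  | right _ => None
  end.

Definition hit_time (w : Omega) : \bar R :=
  if hit_index w is Some n then (\sum_(1 <= k < n.+1) kappa k w)%:E else +oo%E.

Definition hit_state (w : Omega) : option 'I_M :=
  omap (fun n => eta n w) (hit_index w).

Definition cond_prob (A B : set Omega) : R := fine (P (A `&` B)) / fine (P B).

Definition hit_df (i j : 'I_M) (t : R) : R :=
  cond_prob [set w | (hit_time w <= t%:E)%E /\ hit_state w = Some j]
            [set w | eta 0%N w = i].

End process.

Definition Yset (Q : R -> kernelT) (i : 'I_M) : {set 'I_M} :=
  [set j | 0 < trans_prob (Q 1) i j].

Definition tilde_trans_prob (Q : kernelT) (i j : 'I_M) : R :=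
  (j != i)%:R * (trans_prob Q i j / (1 - trans_prob Q i i)).

(* Y, p0 and F0 stand for Y_{1,i}, p_{0,i.} and F_{0,i.}; the last branch is
   the case p_{0,ii} = 1. *)
Definition tilde_laplace (i : 'I_M) (Y : {set 'I_M}) (p0 : 'I_M -> R)
    (F0 : 'I_M -> probability (measurableTypeR R) R) (j : 'I_M) (s : R) : R :=
  if i \notin Y then laplace (F0 j) s
  else if p0 i < 1 then
    (1 - p0 i) * laplace (F0 j) ((1 - p0 i) * s) /
      (1 - p0 i * laplace (F0 i) ((1 - p0 i) * s))
  else 1 / (1 + fine (mean (F0 i)) * s).

End markov_renewal.

(* Main.v *)
Require Import Defs.
From HB Require Import structures.
From mathcomp Require Import all_boot all_order all_algebra.
From mathcomp Require Import all_classical all_reals all_analysis.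
From mathcomp Require Import measurable_realfun.
From mathcomp Require Import ring lra.

Set Implicit Arguments.
Unset Strict Implicit.
Unset Printing Implicit Defensive.

Import Order.TTheory GRing.Theory Num.Theory.
Import numFieldNormedType.Exports.

Local Open Scope classical_set_scope.
Local Open Scope ring_scope.

(* Before hitting D the process stays in i, so the hitting distribution is the
   sum over n of the convolutions Q_ii^{*n} * Q_ij, with Laplace transform
   q_ij / (1 - q_ii).  For a distribution F with tail H and finite mean put
   K(x) = int_0^oo exp(-xu) H(u) du, so that K(0) is the mean and
   x K(x) = 1 - phi(x).  With p = p_ii, the transform of the rescaled hitting
   distribution at s is
     tilde p_ij phi_ij((1 - p) s) / (1 + p s K_ii((1 - p) s)),
   an expression that treats p_{0,ii} < 1 and p_{0,ii} = 1 uniformly.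
   Convergence of F_e and of its mean gives K_e(x_e) -> K_0(x_0) whenever
   x_e -> x_0: the part of the tails below the limit tail is dominated, and the
   excess vanishes because the means converge.  Convergence of Laplace
   transforms is turned back into convergence of distribution functions by
   approximating indicators of rays by 1 - (1 - exp(-sx))^m. *)

(** The delicate case is p_{0,ii} = 1: then 1 - p and 1 - phi_ii((1 - p) s) both tend to 0, and the
    limit of their quotient is governed by the slope of phi_ii at 0, that is by the mean. Weak
    convergence controls phi but not this slope. Hence the detour through K, which needs convergence
    of the means, and hence convergence of K along moving arguments rather than at fixed ones, since
    (1 - p) s itself varies with e. No tightness argument is needed to return from transforms to
    distribution functions: convergence is available at s = 0 as well, so no mass escapes, and (1 -
    exp(-sx))^m is a finite combination of exponentials, so its integrals converge. Limits are taken
    along sequences in ]0, 1]: dominated convergence is sequential, and the hypotheses on the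
    processes concern these e only. *)

Section measure_constructions.
Context d d' (T : measurableType d) (T' : measurableType d') (R : realType).

(** The measure structure on [pushforward] depends on measurability, which [refine] leaves as a
    goal. Ending with [Defined] keeps the value on a set convertible to [mu] of the preimage; many
    later conversions rely on this. *)
Definition image_measure (mu : {measure set T -> \bar R}) (f : T -> T')
    (mf : measurable_fun setT f) : {measure set T' -> \bar R}.
Proof. refine (pushforward mu f : {measure set T' -> \bar R}). exact mf. Defined.

Lemma image_measureE mu f (mf : measurable_fun setT f) A :
  image_measure mu mf A = mu (f @^-1` A).
Proof. by []. Qed.

End measure_constructions.

Section finite_measure_of.
Context d (T : measurableType d) (R : realType).
Variables (mu : {measure set T -> \bar R}) (h : (mu setT < +oo)%E).

(** Taking the proof as an argument gives a head symbol to which an instance depending on that proof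
    can be attached. *)
Definition finite_alias of (mu setT < +oo)%E : set T -> \bar R := mu.

Let finite_alias_fin : fin_num_fun (finite_alias h).
Proof.
move=> A mA; rewrite ge0_fin_numE//; apply: le_lt_trans h.
by apply: le_measure; rewrite ?inE.
Qed.

HB.instance Definition _ := Measure.on (finite_alias h).
HB.instance Definition _ :=
  @Measure_isFinite.Build d T R (finite_alias h) finite_alias_fin.

Definition finite_measure_of : {finite_measure set T -> \bar R} := finite_alias h.

End finite_measure_of.

(** * Measures on the half line: uniqueness, transforms, scaling *)

Section half_line.
Context {R : realType}.
Notation RR := (measurableTypeR R).
Implicit Types (mu nu : {measure set RR -> \bar R}) (s : R).

Lemma measurable_addTR : measurable_fun setT (fun z : RR * RR => z.1 + z.2 : RR).
Proof. exact: (@measurable_funD _ _ R setT fst snd). Qed.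

Lemma measurable_mulTR (c : R) : measurable_fun setT (fun x : RR => x * c : RR).
Proof. exact: (@measurable_funM _ _ R setT id (cst c)). Qed.

Lemma measurable_expM s : measurable_fun setT (fun x : RR => expR (- s * x)).
Proof. by apply: measurableT_comp => //; exact: measurable_funM. Qed.

Lemma measurable_EFin_expM (D : set RR) s :
  measurable_fun D (EFin \o (fun x : RR => expR (- s * x))).
Proof. by apply: measurable_funTS; apply/measurable_EFinP; exact: measurable_expM. Qed.

(** Continuity from below along []-oo, n]] first shows equal total masses; complements then give
    agreement on the rays []x, +oo[], a generating family stable under intersection. This extends
    the Markov property from rays to Borel sets. *)
Lemma measure_eq_rays mu nu : (mu setT < +oo)%E ->
  (forall t, mu `]-oo, t]%classic = nu `]-oo, t]%classic) ->
  forall A, measurable A -> mu A = nu A.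
Proof.
move=> muoo munu.
have cover : \bigcup_n `]-oo, n%:R]%classic = setT :> set RR.
  rewrite -subTset => t _/=.
  by exists (Num.truncn t).+1; rewrite //= in_itv/= ltW// truncnS_gt.
have nd : nondecreasing_seq (fun n => `]-oo, n%:R]%classic : set RR).
  move=> n m nm; apply/subsetPset => x/=; rewrite !in_itv/= => /le_trans.
  by apply; rewrite ler_nat.
have cmu := @nondecreasing_cvg_mu _ _ _ mu _
  (fun n => @measurable_itv _ `]-oo, n%:R]) (bigcup_measurable (fun _ _ => measurable_itv _)) nd.
have cnu := @nondecreasing_cvg_mu _ _ _ nu _
  (fun n => @measurable_itv _ `]-oo, n%:R]) (bigcup_measurable (fun _ _ => measurable_itv _)) nd.
have munuT : mu setT = nu setT.
  move: cmu cnu; rewrite cover.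
  rewrite (_ : mu \o _ = nu \o (fun n => `]-oo, n%:R]%classic)); last first.
    by apply/funext => n /=; rewrite munu.
  by move=> h1 h2; exact: (cvg_unique _ h1 h2).
move=> A mA; apply: (@measure_unique _ R RR (@RGenOInfty.G R)
  (fun n => `](- n%:R)%R, +oo[%classic)) (mA).
- exact: RGenOInfty.measurableE.
- move=> _ _ [x ->] [y ->]; exists (Num.max x y).
  by apply/seteqP; split => z /=; rewrite !in_itv/= !andbT gt_max; [case=> -> ->|move=> /andP[]].
- by move=> n; eexists.
- rewrite -subTset => t _/=.
  by exists (Num.truncn (- t)).+1 => //=; rewrite in_itv/= andbT ltrNl truncnS_gt.
- move=> _ [x ->]; rewrite -setCitvl -!setTD !measureD ?setTI//.
    by congr (_ - _)%E; [exact: munuT|exact: munu].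
  by move: muoo; rewrite munuT.
- move=> n; apply: le_lt_trans muoo.
  by apply: le_measure; rewrite ?inE.
Qed.

Lemma ge0_integral_half_line mu (f : RR -> \bar R) : on_half_line mu ->
  measurable_fun setT f -> (forall x, 0 <= f x)%E ->
  (\int[mu]_(x in `[0%R, +oo[) f x = \int[mu]_x f x)%E.
Proof.
move=> mu0 mf f0; apply/esym.
rewrite -(setUv `[0%R, +oo[%classic) ge0_integral_setU//=; last 2 first.
- by rewrite setUv.
- exact/disj_setPCl.
rewrite [X in (_ + X)%E]null_set_integral ?adde0//.
- exact: measurableC.
- exact: measurable_funTS.
- by rewrite setCitvr.
- exact: measurableC.
Qed.

Lemma on_half_line_sub mu (A : set RR) : on_half_line mu -> measurable A ->
  A `<=` `]-oo, 0[%classic -> mu A = 0%E.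
Proof. by move=> h mA; move=> sA; exact: (subset_measure0 _ _ sA). Qed.

(** The value of [laplace] before [fine], so that Tonelli and series manipulations need no
    finiteness. *)
Definition elaplace mu s : \bar R :=
  (\int[mu]_(t in `[0%R, +oo[) (expR (- s * t))%:E)%E.

Lemma laplaceE mu s : laplace mu s = fine (elaplace mu s).
Proof. by []. Qed.

Lemma elaplace_ge0 mu s : (0 <= elaplace mu s)%E.
Proof. by apply: integral_ge0 => x _; rewrite lee_fin expR_ge0. Qed.

Lemma elaplace0 mu : on_half_line mu -> elaplace mu 0 = mu setT.
Proof.
move=> h; rewrite /elaplace; under eq_integral do rewrite oppr0 mul0r expR0.
by rewrite ge0_integral_half_line// integral_cst// mul1e.
Qed.

Lemma elaplace_le mu s : on_half_line mu -> 0 <= s -> (elaplace mu s <= mu setT)%E.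
Proof.
move=> h s0; rewrite -elaplace0// /elaplace; apply: ge0_le_integral => //.
- exact: measurable_EFin_expM.
- exact: measurable_EFin_expM.
- move=> x /=; rewrite in_itv/= andbT lee_fin ler_expR => x0.
  by rewrite oppr0 mul0r mulNr oppr_le0 mulr_ge0.
Qed.

Lemma elaplace_fin mu s : on_half_line mu -> (mu setT < +oo)%E -> 0 <= s ->
  elaplace mu s \is a fin_num.
Proof.
move=> h muoo s0; rewrite ge0_fin_numE ?elaplace_ge0//.
exact: le_lt_trans (elaplace_le h s0) muoo.
Qed.

(** If [mu] is the law of X, this is the law of cX. The function t -> F(tc) therefore belongs to the
    scaling by the inverse of c, whence the inverses in all uses. *)
Definition scaled mu (c : R) : {measure set RR -> \bar R} :=
  image_measure mu (measurable_mulTR c).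

Lemma scaled_setT mu c : scaled mu c setT = mu setT.
Proof. by rewrite image_measureE preimage_setT. Qed.

Lemma scaled_half_line mu c : 0 < c -> on_half_line mu -> on_half_line (scaled mu c).
Proof.
move=> c0 h; rewrite /on_half_line -[RHS]h.
rewrite -[LHS]/(mu ((fun x : RR => x * c : RR) @^-1` _)); congr (mu _).
by apply/seteqP; split => x /=; rewrite !in_itv/= pmulr_llt0.
Qed.

Lemma dist_fun_scaled mu c t : 0 < c -> dist_fun (scaled mu c^-1) t = dist_fun mu (t * c).
Proof.
move=> c0; rewrite /dist_fun image_measureE; congr (fine (mu _)).
by apply/seteqP; split => x /=; rewrite !in_itv/= ler_pdivrMr.
Qed.

Lemma preimage_scaled_half c : 0 < c ->
  (fun x : RR => x * c : RR) @^-1` `[0%R, +oo[%classic = `[0%R, +oo[%classic.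
Proof.
by move=> c0; apply/seteqP; split => x /=; rewrite !in_itv/= !andbT pmulr_lge0.
Qed.

Lemma elaplace_scaled mu c s : 0 < c -> elaplace (scaled mu c) s = elaplace mu (s * c).
Proof.
move=> c0; rewrite /elaplace ge0_integral_pushforward//.
- rewrite preimage_scaled_half//; apply: eq_integral => x _ /=.
  by congr (expR _)%:E; ring.
- exact: measurable_mulTR.
- exact: measurable_EFin_expM.
Qed.

Lemma mean_scaled mu c : 0 < c -> mean (scaled mu c) = (c%:E * mean mu)%E.
Proof.
move=> c0; rewrite /mean ge0_integral_pushforward//.
- rewrite preimage_scaled_half//.
  rewrite -ge0_integralZl//; last 2 first.
  + by move=> x /=; rewrite in_itv/= andbT lee_fin.
  + by rewrite lee_fin ltW.
  by apply: eq_integral => x _ /=; rewrite -EFinM mulrC.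
- exact: measurable_mulTR.
- by move=> x /=; rewrite inE/= in_itv/= andbT lee_fin.
Qed.

Lemma mscale_half_line mu (k : {nonneg R}) : on_half_line mu -> on_half_line (mscale k mu).
Proof. by rewrite /on_half_line /= /mscale => ->; rewrite mule0. Qed.

Lemma elaplace_mscale mu (k : {nonneg R}) s :
  elaplace (mscale k mu) s = (k%:num%:E * elaplace mu s)%E.
Proof.
rewrite /elaplace ge0_integral_mscale//.
- exact: measurable_EFin_expM.
Qed.

End half_line.

(** * Convolution *)

Section convolution.
Context {R : realType}.
Notation RR := (measurableTypeR R).
Notation fmeas := {finite_measure set RR -> \bar R}.
Implicit Types (mu nu : fmeas) (s : R).

Lemma finite_measure_lty mu : (mu setT < +oo)%E.
Proof. by rewrite -ge0_fin_numE// fin_num_measure. Qed.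

Let conv_image mu nu : {measure set RR -> \bar R} :=
  image_measure (mu \x nu)%E measurable_addTR.

Let conv_image_setT mu nu : conv_image mu nu setT = (mu setT * nu setT)%E.
Proof.
rewrite -[LHS]/((mu \x nu)%E _) preimage_setT.
by rewrite -setXTT product_measure1E.
Qed.

Let conv_image_lty mu nu : (conv_image mu nu setT < +oo)%E.
Proof.
by rewrite conv_image_setT lte_mul_pinfty// ?fin_num_measure// finite_measure_lty.
Qed.

(** Packed as a finite measure, so that it can enter a product measure again and be iterated. *)
Definition convolution mu nu : fmeas := finite_measure_of (conv_image_lty mu nu).

(** A negative sum has a negative term, so the event lies in a union of two null strips. *)
Lemma convolution_half_line mu nu : on_half_line mu -> on_half_line nu ->
  on_half_line (convolution mu nu).
Proof.
move=> hmu hnu; rewrite /on_half_line -[LHS]/((mu \x nu)%E _).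
pose N : set RR := `]-oo, 0%R[%classic.
have mN : measurable N by exact: measurable_itv.
apply: (@subset_measure0 _ _ _ (mu \x nu)%E _
  ((N `*` [set: RR]) `|` ([set: RR] `*` N))).
- rewrite -[X in measurable X]setTI; exact: measurable_addTR.
- by apply: measurableU; exact: measurableX.
- move=> [x y] /=; rewrite /N/= !in_itv/= => xy.
  by have [x0|x0] := ltP x 0; [left|right; split => //; lra].
- apply: (@null_set_setU _ _ _ (mu \x nu)%E).
  + exact: measurableX.
  + exact: measurableX.
  + by apply: (eq_trans (product_measure1E mu nu mN measurableT)); rewrite hmu mul0e.
  + by apply: (eq_trans (product_measure1E mu nu measurableT mN)); rewrite hnu mule0.
Qed.

Lemma elaplace_convolution mu nu s : on_half_line mu -> on_half_line nu ->
  elaplace (convolution mu nu) s = (elaplace mu s * elaplace nu s)%E.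
Proof.
move=> hmu hnu; rewrite /elaplace !ge0_integral_half_line//; last 4 first.
- exact: measurable_EFin_expM.
- exact: measurable_EFin_expM.
- exact: convolution_half_line.
- exact: measurable_EFin_expM.
rewrite ge0_integral_pushforward//; last 2 first.
- exact: measurable_addTR.
- exact: measurable_EFin_expM.
rewrite preimage_setT fubini_tonelli1//=; last first.
  apply/measurable_EFinP.
  apply: (measurableT_comp (measurable_expM s)); exact: measurable_addTR.
rewrite /fubini_F/=.
under eq_integral => x _.
  under eq_integral => y _ do rewrite mulrDr expRD EFinM.
  rewrite ge0_integralZl//; last exact: measurable_EFin_expM.
  over.
rewrite ge0_integralZr//.
- exact: measurable_EFin_expM.
- by apply: integral_ge0 => x _; rewrite lee_fin expR_ge0.
Qed.

Lemma dirac_half_line : on_half_line (\d_(0%R : RR) : {measure set RR -> \bar R}).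
Proof. by rewrite /on_half_line /= diracE memNset//= in_itv/= ltxx. Qed.

Definition dirac0 : fmeas := \d_(0%R : RR).

(** The zeroth power, a unit mass at 0, accounts for leaving i at the first step. *)
Fixpoint conv_pow mu n : fmeas :=
  if n is n'.+1 then convolution (conv_pow mu n') mu else dirac0.

Lemma conv_pow_half_line mu n : on_half_line mu -> on_half_line (conv_pow mu n).
Proof.
move=> h; elim: n => [|n ih]; first exact: dirac_half_line.
exact: convolution_half_line.
Qed.

Lemma elaplace_conv_pow mu s n : on_half_line mu ->
  elaplace (conv_pow mu n) s = (elaplace mu s ^+ n)%E.
Proof.
move=> h; elim: n => [|n ih].
  rewrite /elaplace ge0_integral_half_line//; last 2 first.
  - exact: dirac_half_line.
  - exact: measurable_EFin_expM.
  rewrite integral_dirac//; first by rewrite diracT mul1e mulr0 expR0.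
  exact: measurable_EFin_expM.
rewrite expeS muleC elaplace_convolution ?ih//.
exact: conv_pow_half_line.
Qed.

(* The law of a sum of terms drawn from nu until the first term drawn from mu. *)
Definition renewal mu nu : {measure set RR -> \bar R} :=
  mseries (fun n => convolution (conv_pow nu n) mu) 0.

Lemma renewal_half_line mu nu : on_half_line mu -> on_half_line nu ->
  on_half_line (renewal mu nu).
Proof.
move=> hmu hnu; rewrite /on_half_line /= /mseries eseries0// => n _ _.
by apply: convolution_half_line => //; exact: conv_pow_half_line.
Qed.

Lemma elaplace_renewal mu nu s : on_half_line mu -> on_half_line nu ->
  0 <= s -> laplace nu s < 1 ->
  elaplace (renewal mu nu) s = (laplace mu s / (1 - laplace nu s))%:E.
Proof.
move=> hmu hnu s0 nu1; rewrite /elaplace ge0_integral_measure_series//; last first.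
  exact: measurable_EFin_expM.
have fmu := elaplace_fin hmu (finite_measure_lty mu) s0.
have fnu := elaplace_fin hnu (finite_measure_lty nu) s0.
rewrite (eq_eseriesr (g := EFin \o geometric (laplace mu s) (laplace nu s))); last first.
  move=> n _; rewrite -/(elaplace _ _) elaplace_convolution//; last first.
    exact: conv_pow_half_line.
  rewrite elaplace_conv_pow// /geometric /= /laplace -!/(elaplace _ _).
  by rewrite EFinM EFin_expe !fineK// muleC.
have nu0 : 0 <= laplace nu s by rewrite laplaceE fine_ge0// elaplace_ge0.
apply/cvg_lim => //.
rewrite (_ : (fun n => _) = EFin \o series (geometric (laplace mu s) (laplace nu s))); last first.
  by apply/funext => n /=; rewrite sumEFin.
apply: cvg_EFin; first by apply: nearW.
by apply: cvg_geometric_series; rewrite ger0_norm.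
Qed.

(** This is the transform at s = 0. It also supplies the finiteness of [renewal], which is defined
    as an infinite series. *)
Lemma renewal_setT mu nu : on_half_line mu -> on_half_line nu ->
  total_mass nu < 1 ->
  renewal mu nu setT = (total_mass mu / (1 - total_mass nu))%:E.
Proof.
move=> hmu hnu nu1; have h := renewal_half_line hmu hnu.
have l0 (la : fmeas) : on_half_line la -> laplace la 0 = total_mass la.
  by move=> hla; rewrite laplaceE elaplace0.
by rewrite -elaplace0// elaplace_renewal// ?l0.
Qed.

End convolution.

(** * The continuity theorem for Laplace transforms *)

Section continuity_theorem.
Context {R : realType}.
Notation RR := (measurableTypeR R).
Implicit Types (mu : {measure set RR -> \bar R}).

Lemma bernoulli_ineq (y : R) m : 0 <= y <= 1 -> 1 - (1 - y) ^+ m <= m%:R * y.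
Proof.
move=> /andP[y0 y1]; elim: m => [|m ih]; first by rewrite expr0 subrr mul0r.
have z0 : 0 <= (1 - y) ^+ m <= 1 by rewrite exprn_ge0 ?exprn_ile1//; lra.
rewrite exprS -natr1 [leRHS]mulrDl mul1r mulrBl mul1r; move: ih z0.
move: ((1 - y) ^+ m) (m%:R * y) => z k ih /andP[z0 z1].
have : y * z <= y * 1 by rewrite ler_wpM2l.
by lra.
Qed.

(* The exponent m is about exp(sT) with T the midpoint of a and b, so that
   m exp(-sx) is large for x <= a and small for x >= b when s is large. *)
Lemma exp_step_fun (a b e : R) : 0 <= a -> a < b -> 0 < e ->
  exists s m, 0 <= s /\ forall x, 0 <= x ->
    [/\ 0 <= (1 - expR (- s * x)) ^+ m <= 1,
        x <= a -> (1 - expR (- s * x)) ^+ m <= e &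
        b <= x -> 1 - (1 - expR (- s * x)) ^+ m <= e].
Proof.
move=> a0 ab e0; pose T := (a + b) / 2; pose h := (b - a) / 2.
have h0 : 0 < h by rewrite /h; lra.
have T0 : 0 <= T by rewrite /T; lra.
(* From exp(sh) >= 1 + sh >= 2/e this choice gives exp(-sh) <= e/2; the half absorbs a factor 2 in
   the bound for x >= b. *)
pose s := 2 / e / h.
have s0 : 0 <= s by apply: divr_ge0; [apply: divr_ge0|]; rewrite // ltW.
have sh : expR (- (s * h)) <= e / 2.
  rewrite expRN -[leRHS]invrK lef_pV2 ?posrE ?expR_gt0 ?invr_gt0 ?divr_gt0//.
  rewrite (le_trans _ (expR_ge1Dx _))// /s divfK ?gt_eqF// invf_div.
  by rewrite lerDr.
exists s, (Num.truncn (expR (s * T))).+1; split => // x x0.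
set m := _.+1; set y := expR _.
have y0 : 0 < y by rewrite expR_gt0.
have y1 : y <= 1 by rewrite -expR0 ler_expR mulNr oppr_le0 mulr_ge0.
split; first by rewrite exprn_ge0 ?exprn_ile1//; lra.
(* Here T - x >= h, so m y >= exp(sT) y >= exp(sh) >= sh, and (1 - y)^m <= exp(-m y) <= exp(-sh). *)
- move=> xa; apply: (@le_trans _ _ (expR (- y) ^+ m)).
    rewrite lerXn2r ?nnegrE ?expR_ge0//; first lra.
    by rewrite (le_trans _ (expR_ge1Dx _)).
  rewrite -expRM_natl (@le_trans _ _ (expR (- (s * h))))//; last first.
    by rewrite (le_trans sh)// ler_pdivrMr// ler_peMr// ?ltW//; lra.
  rewrite ler_expR mulrN lerN2.
  apply: (@le_trans _ _ (expR (s * h))); first by have := expR_ge1Dx (s * h); lra.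
  apply: (@le_trans _ _ (expR (s * T) * y)); last first.
    by rewrite ler_wpM2r ?ltW// truncnS_gt.
  rewrite /y -expRD ler_expR mulNr -mulrBr ler_wpM2l// /h /T; lra.
(* Here T - x <= -h. As m <= exp(sT) + 1 <= 2 exp(sT), the bound m y is at most 2 exp(s(T - x)) <= 2
   exp(-sh) <= e. *)
- move=> bx; apply: (le_trans (bernoulli_ineq _ _)); first by rewrite ltW.
  apply: (@le_trans _ _ ((expR (s * T) + 1) * y)).
    apply: ler_wpM2r; first exact: ltW.
    by rewrite /m -natr1 lerD2r; rewrite -truncn_ge_nat ?expR_ge0.
  apply: (@le_trans _ _ ((expR (s * T) + expR (s * T)) * y)).
    apply: ler_wpM2r; first exact: ltW.
    by rewrite lerD2l -expR0 ler_expR mulr_ge0.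
  rewrite mulrDl; have -> : expR (s * T) * y = expR (s * T - s * x).
    by rewrite /y -expRD mulNr.
  have : expR (s * T - s * x) <= expR (- (s * h)).
    rewrite ler_expR -mulrBr -mulrN ler_wpM2l// /h /T; lra.
  move=> /le_trans/(_ sh); lra.
Qed.

Lemma integrable_bounded mu (f : RR -> R) (C : R) : (mu setT < +oo)%E ->
  measurable_fun setT f -> (forall x, 0 <= x -> `|f x| <= C) ->
  mu.-integrable `[0%R, +oo[ (EFin \o f).
Proof.
move=> muoo mf fC.
apply: (@le_integrable _ _ _ mu _ _ _ (EFin \o cst C)) => //.
- exact/measurable_EFinP/measurable_funTS.
- move=> x /=; rewrite in_itv/= andbT => x0; rewrite lee_fin.
  by rewrite (le_trans (fC _ x0))// ler_norm.
- apply/integrableP; split => /=; first exact/measurable_EFinP.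
  rewrite (_ : (fun _ => _) = cst `|C|%:E)// integral_cst//=.
  rewrite lte_mul_pinfty// (le_lt_trans _ muoo)//.
  by apply: le_measure; rewrite ?inE.
Qed.

Lemma integrable_ge0_le1 mu (f : RR -> R) : (mu setT < +oo)%E ->
  measurable_fun setT f -> (forall x, 0 <= x -> 0 <= f x <= 1) ->
  mu.-integrable `[0%R, +oo[ (EFin \o f).
Proof.
move=> muoo mf f01; apply: (integrable_bounded muoo mf) => x x0.
by have /andP[f0 f1] := f01 _ x0; rewrite ger0_norm//; exact: f1.
Qed.

Lemma Rintegral_indic_ray mu t : on_half_line mu ->
  \int[mu]_(x in `[0%R, +oo[) (\1_(`]-oo, t]) x) = dist_fun mu t.
Proof.
move=> h; rewrite /Rintegral /dist_fun ge0_integral_half_line//.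
- by rewrite integral_indic// setIT.
- exact/measurable_EFinP/measurable_indic.
Qed.

Lemma measurable_exp_mul_pow s r m :
  measurable_fun setT (fun x : RR => expR (- r * x) * (1 - expR (- s * x)) ^+ m).
Proof.
apply: measurable_funM; first exact: measurable_expM.
by apply: measurable_funX; apply: measurable_funB => //; exact: measurable_expM.
Qed.

Lemma exp_mul_pow_ge0_le1 (s r x : R) m : 0 <= s -> 0 <= r -> 0 <= x ->
  0 <= expR (- r * x) * (1 - expR (- s * x)) ^+ m <= 1.
Proof.
move=> s0 r0 x0.
have e01 q : 0 <= q -> 0 <= expR (- q * x) <= 1.
  by move=> q0; rewrite expR_ge0 -expR0 ler_expR mulNr oppr_le0 mulr_ge0.
have /andP[a0 a1] := e01 _ s0; have /andP[b0 b1] := e01 _ r0.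
by rewrite mulr_ge0 ?exprn_ge0 ?mulr_ile1 ?exprn_ge0 ?exprn_ile1//; lra.
Qed.

(** The integral of 1 - (1 - exp(-sx))^m, a smoothed indicator of a ray. The constant is integrated
    separately as the transform at 0, so that convergence can be shown term by term. *)
Definition exp_step mu s m : R :=
  laplace mu 0 - \int[mu]_(x in `[0%R, +oo[) ((1 - expR (- s * x)) ^+ m).

(** Pointwise, the step function differs by at most e from something between the indicators of
    []-oo, a]] and []-oo, b]]; integrating turns e into e times the total mass. *)
Lemma exp_step_bounds mu a b e s m : on_half_line mu -> (mu setT < +oo)%E ->
  0 < e -> 0 <= s -> (forall x, 0 <= x ->
    [/\ 0 <= (1 - expR (- s * x)) ^+ m <= 1,
        x <= a -> (1 - expR (- s * x)) ^+ m <= e &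
        b <= x -> 1 - (1 - expR (- s * x)) ^+ m <= e]) ->
  dist_fun mu a <= exp_step mu s m + e * laplace mu 0 /\
  exp_step mu s m <= dist_fun mu b + e * laplace mu 0.
Proof.
move=> hmu muoo e0 s0 hsm.
(* The constant 1 is kept as [expR (- 0 * x)], whose integral is [laplace mu 0] by definition. *)
have i1 : mu.-integrable `[0%R, +oo[ (EFin \o (fun x : RR => expR (- 0 * x))).
  apply: integrable_ge0_le1 => //; first exact: measurable_expM.
  by move=> x _; rewrite oppr0 mul0r expR0 ler01 lexx.
have iq : mu.-integrable `[0%R, +oo[ (EFin \o (fun x : RR => (1 - expR (- s * x)) ^+ m)).
  apply: integrable_ge0_le1 => //.
    by apply: measurable_funX; apply: measurable_funB => //; exact: measurable_expM.
  by move=> x x0; have [] := hsm _ x0.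
have iI t : mu.-integrable `[0%R, +oo[ (EFin \o (fun x : RR => \1_(`]-oo, t]) x)).
  apply: integrable_ge0_le1 => //; first exact: measurable_indic.
  by move=> x _; rewrite indicE; case: (_ \in _); rewrite /= ?ler01 ?lexx.
have mq : measurable_fun setT (fun x : RR => expR (- 0 * x) - (1 - expR (- s * x)) ^+ m).
  apply: measurable_funB; first exact: measurable_expM.
  by apply: measurable_funX; apply: measurable_funB => //; exact: measurable_expM.
have me : measurable_fun setT (fun x : RR => e * expR (- 0 * x)).
  by apply: measurable_funM => //; exact: measurable_expM.
have q01 x : 0 <= x -> `|expR (- 0 * x) - (1 - expR (- s * x)) ^+ m| <= 1.
  move=> x0; have [/andP[q0 q1] _ _] := hsm _ x0.
  by rewrite oppr0 mul0r expR0 ger0_norm; lra.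
have ele x : `|e * expR (- 0 * x)| <= `|e| by rewrite oppr0 mul0r expR0 mulr1.
have i1q := integrable_bounded muoo mq q01.
have ie := integrable_bounded muoo me (fun x _ => ele x).
have isum (f g : RR -> R) : mu.-integrable `[0%R, +oo[ (EFin \o f) ->
    mu.-integrable `[0%R, +oo[ (EFin \o g) ->
    mu.-integrable `[0%R, +oo[ (EFin \o (fun x => f x + g x)).
  move=> hf hg; have := @integrableD _ _ _ mu _ (measurable_itv _) _ _ hf hg.
  by apply: eq_integrable => // x _ /=; rewrite EFinD.
have eE : exp_step mu s m =
  \int[mu]_(x in `[0%R, +oo[) (expR (- 0 * x) - (1 - expR (- s * x)) ^+ m).
  by rewrite RintegralB.
rewrite eE -!Rintegral_indic_ray//.
rewrite -[e * laplace mu 0](RintegralZl e _ i1)//.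
rewrite -!RintegralD//; split; apply: le_Rintegral => //.
- exact: isum.
- move=> x /=; rewrite in_itv/= andbT => x0.
  have [/andP[q0 q1] qa qb] := hsm _ x0.
  rewrite oppr0 mul0r expR0 mulr1 indicE; case: (boolP (x \in _)); last by move=> _ /=; lra.
  by rewrite inE/= in_itv/= => /qa; lra.
- exact: isum.
- move=> x /=; rewrite in_itv/= andbT => x0.
  have [/andP[q0 q1] qa qb] := hsm _ x0.
  rewrite oppr0 mul0r expR0 mulr1 indicE; case: (boolP (x \in _)) => /=; first lra.
  by rewrite notin_setE/= in_itv/= => /negP; rewrite -ltNge => /ltW /qb; lra.
Qed.

Variables (mu_ : nat -> {measure set RR -> \bar R}) (mu0 : {measure set RR -> \bar R}).
Hypotheses (hmu_ : forall n, on_half_line (mu_ n)) (hmu0 : on_half_line mu0).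
Hypotheses (fmu_ : forall n, (mu_ n setT < +oo)%E) (fmu0 : (mu0 setT < +oo)%E).
Hypothesis laplace_cvg : forall s, 0 <= s ->
  laplace (mu_ n) s @[n --> \oo] --> laplace mu0 s.

(** Splitting off one factor 1 - exp(-sx) leaves two integrals of degree m, one with r replaced by r
    + s. Hence the induction on m for all r at once; degree 0 is the convergence of transforms. *)
Lemma Rintegral_exp_mul_pow_cvg s r m : 0 <= s -> 0 <= r ->
  \int[mu_ n]_(x in `[0%R, +oo[) (expR (- r * x) * (1 - expR (- s * x)) ^+ m)
    @[n --> \oo] -->
  \int[mu0]_(x in `[0%R, +oo[) (expR (- r * x) * (1 - expR (- s * x)) ^+ m).
Proof.
move=> s0; elim: m r => [|m ih] r r0.
  have E mu : \int[mu]_(x in `[0%R, +oo[)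
      (expR (- r * x) * (1 - expR (- s * x)) ^+ 0) = laplace mu r.
    by apply: eq_Rintegral => x _; rewrite expr0 mulr1.
  by rewrite E; under eq_fun do rewrite E; exact: laplace_cvg.
have E mu : (mu setT < +oo)%E ->
  \int[mu]_(x in `[0%R, +oo[) (expR (- r * x) * (1 - expR (- s * x)) ^+ m.+1) =
  \int[mu]_(x in `[0%R, +oo[) (expR (- r * x) * (1 - expR (- s * x)) ^+ m) -
  \int[mu]_(x in `[0%R, +oo[) (expR (- (r + s) * x) * (1 - expR (- s * x)) ^+ m).
  move=> muoo; rewrite -RintegralB//.
  - by apply: eq_Rintegral => x _; rewrite opprD mulrDl expRD exprS; ring.
  - apply: integrable_ge0_le1 => //; first exact: measurable_exp_mul_pow.
    by move=> x x0; exact: exp_mul_pow_ge0_le1.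
  - apply: integrable_ge0_le1 => //; first exact: measurable_exp_mul_pow.
    by move=> x x0; apply: exp_mul_pow_ge0_le1 => //; rewrite addr_ge0.
rewrite E//; under eq_fun do rewrite E//.
by apply: cvgB; apply: ih => //; rewrite addr_ge0.
Qed.

Lemma exp_step_cvg s m : 0 <= s -> exp_step (mu_ n) s m @[n --> \oo] --> exp_step mu0 s m.
Proof.
move=> s0; apply: cvgB; first exact: laplace_cvg.
have := @Rintegral_exp_mul_pow_cvg s 0 m s0 (lexx 0).
have E mu : \int[mu]_(x in `[0%R, +oo[)
    (expR (- 0 * x) * (1 - expR (- s * x)) ^+ m) =
  \int[mu]_(x in `[0%R, +oo[) ((1 - expR (- s * x)) ^+ m).
  by apply: eq_Rintegral => x _; rewrite oppr0 mul0r expR0 mul1r.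
by rewrite E; under eq_fun do rewrite E.
Qed.

Lemma laplace0_ge0 mu : 0 <= laplace mu 0.
Proof. by rewrite laplaceE fine_ge0// elaplace_ge0. Qed.

(** The error k times the mass is met twice, once along the sequence and once in the limit. Adding 1
    to the mass avoids dividing by 0. *)
Let small e : 0 < e -> exists2 k, 0 < k & 2 * (k * laplace mu0 0) < e.
Proof.
move=> e0; have l0 := laplace0_ge0 mu0; exists (e / 2 / (laplace mu0 0 + 1)).
  by rewrite !divr_gt0// ltr_wpDl.
rewrite (_ : 2 * _ = e * (laplace mu0 0 / (laplace mu0 0 + 1))); last first.
  by field; rewrite gt_eqF// ltr_wpDl.
by rewrite gtr_pMr// ltr_pdivrMr ?ltr_wpDl// mul1r ltrDl.
Qed.

(** A step function descending between t and u separates the two values, so continuity of the limit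
    is not involved yet: F_n(t) is at most the step integral plus an error, which converges, and the
    limit step integral is at most F_0(u) plus an error. *)
Lemma dist_fun_limsup t u e : 0 <= t -> t < u -> 0 < e ->
  \forall n \near \oo, dist_fun (mu_ n) t < dist_fun mu0 u + e.
Proof.
move=> t0 tu e0; have [k k0 ke] := small e0.
have [s [m [s0 hsm]]] := exp_step_fun t0 tu k0.
have : exp_step (mu_ n) s m + k * laplace (mu_ n) 0 @[n --> \oo] -->
       exp_step mu0 s m + k * laplace mu0 0.
  apply: cvgD; first exact: exp_step_cvg.
  by apply: cvgMr; exact: laplace_cvg.
move=> /cvgr_lt /(_ (dist_fun mu0 u + e)) H.
have [_ B0] := exp_step_bounds hmu0 fmu0 k0 s0 hsm.
have : exp_step mu0 s m + k * laplace mu0 0 < dist_fun mu0 u + e by lra.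
move=> /H; apply: filterS => n; apply: le_lt_trans.
by have [] := exp_step_bounds (hmu_ n) (fmu_ n) k0 s0 hsm.
Qed.

Lemma dist_fun_liminf t u e : 0 <= t -> t < u -> 0 < e ->
  \forall n \near \oo, dist_fun mu0 t < dist_fun (mu_ n) u + e.
Proof.
move=> t0 tu e0; have [k k0 ke] := small e0.
have [s [m [s0 hsm]]] := exp_step_fun t0 tu k0.
have : exp_step (mu_ n) s m - k * laplace (mu_ n) 0 @[n --> \oo] -->
       exp_step mu0 s m - k * laplace mu0 0.
  apply: cvgB; first exact: exp_step_cvg.
  by apply: cvgMr; exact: laplace_cvg.
move=> /cvgr_gt /(_ (dist_fun mu0 t - e)) H.
have [A0 _] := exp_step_bounds hmu0 fmu0 k0 s0 hsm.
have : dist_fun mu0 t - e < exp_step mu0 s m - k * laplace mu0 0 by lra.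
move=> /H; apply: filterS => n.
have [_] := exp_step_bounds (hmu_ n) (fmu_ n) k0 s0 hsm; lra.
Qed.

Lemma dist_fun_lt0 mu t : on_half_line mu -> t < 0 -> dist_fun mu t = 0.
Proof.
move=> h t0; rewrite /dist_fun (on_half_line_sub h)//.
by move=> x /=; rewrite !in_itv/= => /le_lt_trans; apply.
Qed.

Lemma dist_fun_ge0 mu t : 0 <= dist_fun mu t.
Proof. by rewrite fine_ge0. Qed.

Lemma laplace_continuity t : {for t, continuous (dist_fun mu0)} ->
  dist_fun (mu_ n) t @[n --> \oo] --> dist_fun mu0 t.
Proof.
have [t0 _|t0 ct] := ltP t 0.
  rewrite dist_fun_lt0//; under eq_fun do rewrite dist_fun_lt0//.
  exact: cvg_cst.
apply/cvgrPdist_lt => e e0.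
have e2 : 0 < e / 2 by rewrite divr_gt0.
have /cvgrPdist_lt /(_ _ e2) [r/= r0 hr] := ct.
have up := dist_fun_limsup t0 (_ : t < t + r / 2) e2.
have Fu : `|dist_fun mu0 t - dist_fun mu0 (t + r / 2)| < e / 2.
  by apply: hr; rewrite /ball/= opprD addrA subrr add0r normrN gtr0_norm ?divr_gt0//; lra.
have Fl : `|dist_fun mu0 t - dist_fun mu0 (t - r / 2)| < e / 2.
  by apply: hr; rewrite /ball/= opprB addrCA subrr addr0 gtr0_norm ?divr_gt0//; lra.
have lo : \forall n \near \oo, dist_fun mu0 (t - r / 2) < dist_fun (mu_ n) t + e / 2.
  (* The step functions are controlled on the half line only, so a negative left end is treated
     apart: there the limit distribution function is 0. *)
  have [tr|tr] := ltP (t - r / 2) 0.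
    by apply: nearW => n; rewrite dist_fun_lt0// ltr_wpDl// dist_fun_ge0.
  by apply: dist_fun_liminf => //; lra.
near=> n.
have Un : dist_fun (mu_ n) t < dist_fun mu0 (t + r / 2) + e / 2.
  by near: n; apply: up; lra.
have Ln : dist_fun mu0 (t - r / 2) < dist_fun (mu_ n) t + e / 2 by near: n.
have := Fu; have := Fl; rewrite !ltr_norml => /andP[? ?] /andP[? ?].
by apply/andP; split; lra.
Unshelve. all: by end_near. Qed.

End continuity_theorem.

(** * Integrated tails *)

Section integrated_tail.
Context {R : realType}.
Notation RR := (measurableTypeR R).
Notation leb := (@lebesgue_measure R).
Implicit Types (mu : {measure set RR -> \bar R}).

Definition tail mu (u : R) : R := fine (mu `]u, +oo[%classic).

(** This is K. Being real-valued, it takes the default value 0 when the integral diverges, so its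
    uses at x = 0 come with a finite mean. *)
Definition integrated_tail mu (x : R) : R :=
  \int[leb]_(u in `[0%R, +oo[) (expR (- x * u) * tail mu u).

Lemma tail_ge0 mu u : 0 <= tail mu u.
Proof. by rewrite fine_ge0. Qed.

Lemma tailE mu u : (mu setT < +oo)%E -> (tail mu u)%:E = mu `]u, +oo[%classic.
Proof.
move=> muoo; rewrite fineK// ge0_fin_numE// (le_lt_trans _ muoo)//.
by apply: le_measure; rewrite ?inE.
Qed.

Lemma tail_nonincreasing mu : (mu setT < +oo)%E ->
  {homo tail mu : u v / u <= v >-> v <= u}.
Proof.
move=> muoo u v uv; rewrite -lee_fin !tailE//; apply: le_measure; rewrite ?inE//.
by move=> x /=; rewrite !in_itv/= !andbT; exact: le_lt_trans.
Qed.

Lemma measurable_tail mu D : (mu setT < +oo)%E -> measurable D ->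
  measurable_fun D (tail mu : RR -> R).
Proof.
move=> muoo mD.
have -> : tail mu = (fun u => - - tail mu u) by apply/funext => u; rewrite opprK.
apply: measurable_funN; apply: nondecreasing_measurable => // u v uv.
by rewrite lerN2; exact: tail_nonincreasing.
Qed.

(** Tonelli on the region 0 <= u < t. The choice g = 1 expresses the mean through the tail, and g(u)
    = x exp(-xu) expresses 1 - phi(x). *)
Lemma integral_ray_tail mu (g : RR -> R) : (mu setT < +oo)%E -> on_half_line mu ->
  measurable_fun setT g -> (forall u, 0 <= g u) ->
  (\int[mu]_(t in `[0%R, +oo[) \int[leb]_(u in `[0%R, t[) (g u)%:E =
   \int[leb]_(u in `[0%R, +oo[) (g u * tail mu u)%:E)%E.
Proof.
move=> muoo hmu mg g0.
pose A : set (RR * RR) := [set z | (0 <= z.2) && (z.2 < z.1)].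
have mA : measurable A.
  rewrite (_ : A = (setT `*` `[0%R, +oo[%classic) `&`
    (setT `&` (fun z : RR * RR => z.2 < z.1) @^-1` [set true])); last first.
    apply/seteqP; split => -[t u] /=; rewrite /A/= in_itv/= andbT.
      by move=> /andP[-> ->].
    by move=> [[_ ->] [_ ->]].
  apply: measurableI; first exact: measurableX.
  by apply: (measurable_fun_ltr measurable_snd measurable_fst).
pose f (z : RR * RR) : \bar R := (g z.2 * \1_A z)%:E.
have mf : measurable_fun setT f.
  apply/measurable_EFinP; apply: measurable_funM.
    exact: measurableT_comp.
  exact: measurable_indic.
have f0 z : (0 <= f z)%E by rewrite lee_fin mulr_ge0.
pose nu := finite_measure_of muoo.
have E1 t : (\int[leb]_u f (t, u) = \int[leb]_(u in `[0%R, t[) (g u)%:E)%E.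
  rewrite [RHS]integral_mkcond; apply: eq_integral => u _.
  rewrite /f patchE indicE /A /=.
  have -> : ((t, u) \in A) = (u \in `[0%R, t[%classic).
    by apply/idP/idP => /set_mem/= h; apply/mem_set; move: h; rewrite /A/= ?in_itv.
  by case: ifP => _; rewrite ?mulr1 ?mulr0.
transitivity (\int[nu]_t \int[leb]_u f (t, u))%E.
  under eq_integral do rewrite -E1.
  apply: ge0_integral_half_line => //.
    exact: measurable_fun_fubini_tonelli_F.
  by move=> t; apply: integral_ge0.
rewrite (fubini_tonelli f)// [RHS]integral_mkcond.
apply: eq_integral => u _; rewrite patchE; case: ifPn; last first.
  rewrite notin_setE/= in_itv/= andbT => /negP u0.
  rewrite integral0_eq// => t _; rewrite /f indicE memNset ?mulr0//.
  by rewrite /A/=; apply/negP; rewrite negb_and u0.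
rewrite inE/= in_itv/= andbT => u0.
under eq_integral.
  move=> t _; rewrite /f EFinM.
  have -> : \1_A (t, u) = \1_(`]u, +oo[) t :> R.
    rewrite !indicE; congr (_%:R); congr nat_of_bool.
    by apply/idP/idP => /set_mem/= h; apply/mem_set; move: h; rewrite /A/= ?in_itv/= ?u0 ?andbT.
  over.
rewrite /= ge0_integralZl//; last 2 first.
- by apply/measurable_EFinP; exact: measurable_indic.
- by rewrite lee_fin.
by rewrite integral_indic// setIT EFinM tailE.
Qed.

(** The integrand is the exponential density of rate x, so its integral over an interval from 0 is
    read off the exponential law. *)
Lemma integral_exp_ray (x t : R) : 0 < x -> 0 <= t ->
  (\int[leb]_(u in `[0%R, t[) (x * expR (- x * u))%:E = (1 - expR (- x * t))%:E)%E.
Proof.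
move=> x0; rewrite le_eqVlt => /predU1P[<-|t0].
  by rewrite set_itv_ge ?bnd_simp ?ltxx// integral_set0 mulr0 expR0 subrr.
rewrite integral_itv_bndo_bndc; last first.
  apply/measurable_EFinP; apply: measurable_funTS.
  by apply: measurable_funM => //; exact: measurable_expM.
rewrite EFinB -exponential_prob_itv0c//; apply: eq_integral => u.
by rewrite inE/= in_itv/= => /andP[u0 _]; rewrite exponential_pdfE.
Qed.

Lemma mean_tail mu : (mu setT < +oo)%E -> on_half_line mu ->
  (\int[leb]_(u in `[0%R, +oo[) (tail mu u)%:E = mean mu)%E.
Proof.
move=> muoo hmu.
under eq_integral do rewrite -[tail _ _]mul1r.
rewrite -(integral_ray_tail (g := cst 1))//; apply: eq_integral => t.
rewrite inE/= in_itv/= andbT => t0.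
rewrite (_ : (\int[leb]_(_ in _) _)%E = leb (`[0%R, t[%classic : set R)); last first.
  by rewrite integral_cst// mul1e.
rewrite lebesgue_measure_itv/= lte_fin.
by case: ltP => [|t1]; rewrite ?sube0//; apply/eqP; rewrite eqe eq_le t0 t1.
Qed.

Section finite_mean.
Variable mu : {measure set RR -> \bar R}.
Hypotheses (muoo : (mu setT < +oo)%E) (hmu : on_half_line mu) (mmu : (mean mu < +oo)%E).

Lemma integrable_tail : leb.-integrable `[0%R, +oo[ (EFin \o tail mu).
Proof.
apply/integrableP; split; first by apply/measurable_EFinP; exact: measurable_tail.
under eq_integral do rewrite /= ger0_norm ?tail_ge0//.
by rewrite mean_tail.
Qed.

Lemma measurable_exp_tail (x : R) :
  measurable_fun (`[0%R, +oo[%classic : set RR) (fun u : RR => expR (- x * u) * tail mu u).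
Proof.
apply: measurable_funM; last exact: measurable_tail.
by apply: measurable_funTS; exact: measurable_expM.
Qed.

Lemma exp_tail_ge0 x u : 0 <= expR (- x * u) * tail mu u.
Proof. by rewrite mulr_ge0 ?expR_ge0 ?tail_ge0. Qed.

Lemma exp_tail_le x u : 0 <= x -> 0 <= u -> expR (- x * u) * tail mu u <= tail mu u.
Proof.
move=> x0 u0; rewrite ler_piMl ?tail_ge0// -expR0 ler_expR.
by rewrite mulNr oppr_le0 mulr_ge0.
Qed.

Lemma integrable_exp_tail x : 0 <= x ->
  leb.-integrable `[0%R, +oo[ (EFin \o (fun u => expR (- x * u) * tail mu u)).
Proof.
move=> x0; apply: (le_integrable _ _ _ integrable_tail) => //.
- by apply/measurable_EFinP; exact: measurable_exp_tail.
- move=> u /=; rewrite in_itv/= andbT => u0; rewrite lee_fin.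
  by rewrite !ger0_norm ?tail_ge0 ?exp_tail_ge0// exp_tail_le.
Qed.

Lemma integrated_tail0 : integrated_tail mu 0 = fine (mean mu).
Proof.
rewrite -mean_tail//; congr fine; apply: eq_integral => u _.
by rewrite oppr0 mul0r expR0 mul1r.
Qed.

(** For x > 0 this is [integral_ray_tail] with g(u) = x exp(-xu), whose integral over [[0, t[] is 1
    - exp(-xt). The case x = 0 is separate, since no exponential density has rate 0. *)
Lemma laplace_integrated_tail x : 0 <= x ->
  x * integrated_tail mu x = laplace mu 0 - laplace mu x.
Proof.
rewrite le_eqVlt => /predU1P[<-|x0]; first by rewrite mul0r subrr.
have i r : 0 <= r -> mu.-integrable `[0%R, +oo[ (EFin \o (fun t : RR => expR (- r * t))).
  move=> r0; apply: integrable_ge0_le1 => //; first exact: measurable_expM.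
  by move=> t t0; rewrite expR_ge0 -expR0 ler_expR mulNr oppr_le0 mulr_ge0.
rewrite /laplace -[RHS](RintegralB (mu := mu))//; [|exact: i|exact/i/ltW].
rewrite -RintegralZl//; last by apply: integrable_exp_tail; exact: ltW.
rewrite /Rintegral; congr fine.
under [LHS]eq_integral do rewrite mulrA.
rewrite -integral_ray_tail//.
- apply: eq_integral => t; rewrite inE/= in_itv/= andbT => t0.
  by rewrite integral_exp_ray// oppr0 mul0r expR0.
- by apply: measurable_funM => //; exact: measurable_expM.
- by move=> u; rewrite mulr_ge0 ?expR_ge0// ltW.
Qed.

Lemma integrated_tail_ge0 x : 0 <= integrated_tail mu x.
Proof. by apply: Rintegral_ge0 => u _; exact: exp_tail_ge0. Qed.

End finite_mean.

End integrated_tail.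

(** * Convergence of integrated tails from convergence of laws and means *)

Section integrated_tail_cvg.
Context {R : realType}.
Notation RR := (measurableTypeR R).
Notation leb := (@lebesgue_measure R).

(** Taking the minimum with a constant is nonexpansive. *)
Lemma cvg_minl (u : nat -> R) (a c : R) : u n @[n --> \oo] --> a ->
  Num.min (u n) c @[n --> \oo] --> Num.min a c.
Proof.
move=> /cvgrPdist_le ua; apply/cvgrPdist_le => e e0.
apply: filterS (ua _ e0) => n; rewrite !ler_norml => /andP[? ?].
rewrite /Order.min.
by case: (ltP a c); case: (ltP (u n) c) => *; apply/andP; split; lra.
Qed.

Lemma dist_fun_le (mu : {measure set RR -> \bar R}) : (mu setT < +oo)%E ->
  {homo dist_fun mu : s t / s <= t}.
Proof.
move=> muoo s t st; rewrite fine_le ?ge0_fin_numE//.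
- by apply: le_lt_trans muoo; apply: le_measure; rewrite ?inE.
- by apply: le_lt_trans muoo; apply: le_measure; rewrite ?inE.
- apply: le_measure; rewrite ?inE//.
  by move=> x /=; rewrite !in_itv/= => /le_trans; apply.
Qed.

Lemma dist_fun_tail (mu : {measure set RR -> \bar R}) t : mu setT = 1%E ->
  tail mu t = 1 - dist_fun mu t.
Proof.
move=> mu1; have muoo : (mu setT < +oo)%E by rewrite mu1 ltry.
have lt1 (A : set RR) : measurable A -> mu A \is a fin_num.
  by move=> mA; rewrite ge0_fin_numE// (le_lt_trans _ muoo)// le_measure ?inE.
apply/eqP; rewrite eq_sym subr_eq addrC; apply/eqP.
rewrite /tail /dist_fun -fineD; [|exact: lt1|exact: lt1].
rewrite -measureU//; last first.
  rewrite -subset0 => x /=; rewrite !in_itv/= andbT => -[].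
  by rewrite leNgt => /negP.
transitivity (fine (mu [set: RR])); first by rewrite mu1.
congr (fine (mu _)); apply/esym; rewrite -subTset => x _ /=; rewrite !in_itv/= andbT.
by have [|] := leP x t; [left|right].
Qed.

(** Continuity of the measure along the rays ending at t + 1/(n+1) and t - 1/(n+1) gives both
    one-sided limits, the absence of an atom makes the left one equal to the value, and monotonicity
    fills in the other points. *)
Lemma continuous_dist_fun (mu : {measure set RR -> \bar R}) (t : R) :
  (mu setT < +oo)%E -> mu [set (t : RR)] = 0%E -> {for t, continuous (dist_fun mu)}.
Proof.
move=> muoo mut.
have fn (A : set RR) : measurable A -> mu A \is a fin_num.
  by move=> mA; rewrite ge0_fin_numE// (le_lt_trans _ muoo)// le_measure ?inE.
have cr : dist_fun mu (t + n.+1%:R^-1) @[n --> \oo] --> dist_fun mu t.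
  apply: fine_cvg; rewrite fineK ?fn//.
  rewrite [in X in _ --> X](itvNycEbigcap false).
  apply: (@nonincreasing_cvg_mu _ _ _ mu (fun n => `]-oo, t + n.+1%:R^-1]%classic)) => //.
  - by apply: le_lt_trans muoo; apply: le_measure; rewrite ?inE.
  - exact: bigcap_measurable.
  - move=> m n mn; apply/subsetPset; apply: subset_itvl.
    by rewrite bnd_simp lerD2l lef_pV2 ?posrE// ler_nat.
have cl : dist_fun mu (t - n.+1%:R^-1) @[n --> \oo] --> dist_fun mu t.
  apply: fine_cvg; rewrite fineK ?fn//.
  have -> : mu `]-oo, t]%classic = mu (\bigcup_n `]-oo, t - n.+1%:R^-1]%classic).
    rewrite (_ : \bigcup_n _ = `]-oo, t[%classic); last first.
      apply/seteqP; split => [x [n _]/=|x /=]; rewrite !in_itv/=.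
        by move=> /le_lt_trans; apply; rewrite ltrBlDr ltrDl invr_gt0.
      move=> xt; near \oo => n; exists n => //=; rewrite in_itv/= lerBrDr -lerBrDl.
      near: n; have tx : 0 < t - x by rewrite subr_gt0.
      by apply: filterS (near_infty_natSinv_lt (PosNum tx)) => n /ltW.
    rewrite -(@setUitv1 _ _ -oo%O t true)// measureU//.
    + by apply: (eq_trans (congr1 (fun z => (_ + z)%E) mut)); exact: adde0.
    + by rewrite -subset0 => x /=; rewrite in_itv/= => -[] /[swap] ->; rewrite ltxx.
  apply: (@nondecreasing_cvg_mu _ _ _ mu (fun n => `]-oo, t - n.+1%:R^-1]%classic)) => //.
  - exact: bigcup_measurable.
  - move=> m n mn; apply/subsetPset; apply: subset_itvl.
    by rewrite bnd_simp lerD2l lerN2 lef_pV2 ?posrE// ler_nat.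
apply/cvgrPdist_lt => e e0.
near \oo => n.
have Hr : `|dist_fun mu t - dist_fun mu (t + n.+1%:R^-1)| < e.
  by near: n; move/cvgrPdist_lt : cr; exact.
have Hl : `|dist_fun mu t - dist_fun mu (t - n.+1%:R^-1)| < e.
  by near: n; move/cvgrPdist_lt : cl; exact.
exists n.+1%:R^-1; rewrite /= ?invr_gt0// => u /=; rewrite ltr_norml => /andP[u1 u2].
have := Hr; have := Hl; rewrite !ltr_norml => /andP[? ?] /andP[? ?].
have ul : dist_fun mu (t - n.+1%:R^-1) <= dist_fun mu u.
  by apply: dist_fun_le => //; rewrite lerBlDr -lerBlDl ltW.
have ur : dist_fun mu u <= dist_fun mu (t + n.+1%:R^-1).
  by apply: dist_fun_le => //; rewrite -lerBlDl -opprB lerNl ltW.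
by apply/andP; split; lra.
Unshelve. all: by end_near. Qed.

(** The measure is viewed as the law of the identity random variable, whose probability mass
    function has countable support. *)
Lemma countable_atoms (P : probability RR R) : countable [set t | P [set t] != 0%E].
Proof.
pose X : RR -> R := idfun.
have mX : measurable_fun setT X by exact: measurable_id.
pose XX : {RV P >-> R} := HB.pack_for {RV P >-> R} X (isMeasurableFun.Build _ _ _ _ X mX).
apply: sub_countable (pmf_gt0_countable XX).
apply: subset_card_le => t /= Pt0; rewrite /pmf fine_gt0//.
rewrite lt0e Pt0 measure_ge0 /= -[X in (X < _)%E]/(P [set t]).
by apply: (@le_lt_trans _ _ 1%E); [apply: probability_le1|exact: ltry].
Qed.

(** The exceptional set is the countable set of atoms. Convergence at continuity points thus becomes
    almost everywhere convergence for Lebesgue measure, as dominated convergence requires. *)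
Lemma ae_continuous_dist_fun (P : probability RR R) :
  {ae leb, forall t, {for t, continuous (dist_fun P)}}.
Proof.
have Poo : (P setT < +oo)%E by rewrite probability_setT ltry.
exists [set t | P [set t] != 0%E]; split.
- exact/countable_measurable/countable_atoms.
- exact/countable_lebesgue_measure0/countable_atoms.
- move=> t /= h; apply/eqP => Pt0; apply: h.
  exact: continuous_dist_fun.
Qed.

Variables (nu_ : nat -> {measure set RR -> \bar R}) (nu0 : probability RR R).
Hypotheses (nu1 : forall n, nu_ n setT = 1%E).
Hypotheses (hnu_ : forall n, on_half_line (nu_ n)) (hnu0 : on_half_line nu0).
Hypotheses (mnu_ : forall n, (mean (nu_ n) < +oo)%E) (mnu0 : (mean nu0 < +oo)%E).
Hypothesis dist_fun_cvg : forall t, {for t, continuous (dist_fun nu0)} ->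
  dist_fun (nu_ n) t @[n --> \oo] --> dist_fun nu0 t.
Hypothesis mean_cvg : fine (mean (nu_ n)) @[n --> \oo] --> fine (mean nu0).

Let nuoo n : (nu_ n setT < +oo)%E. Proof. by rewrite nu1 ltry. Qed.
Let nu0oo : (nu0 setT < +oo)%E. Proof. by rewrite probability_setT ltry. Qed.

(* Truncating at the limit tail provides a dominated sequence. *)
Let trunc n x u := Num.min (expR (- x * u) * tail (nu_ n) u) (tail nu0 u).

Let trunc_ge0 n x u : 0 <= trunc n x u.
Proof. by rewrite le_min exp_tail_ge0 tail_ge0. Qed.

Let measurable_trunc n x : measurable_fun (`[0%R, +oo[%classic : set RR) (trunc n x : RR -> R).
Proof.
apply: measurable_minr; first exact: measurable_exp_tail.
exact: measurable_tail.
Qed.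

Let integrable_trunc n x : leb.-integrable `[0%R, +oo[ (EFin \o trunc n x).
Proof.
apply: (le_integrable _ _ _ (integrable_tail nu0oo hnu0 mnu0)) => //.
- by apply/measurable_EFinP; exact: measurable_trunc.
- move=> u _; rewrite /= lee_fin !ger0_norm ?tail_ge0 ?trunc_ge0//.
  by rewrite /trunc ge_min lexx orbT.
Qed.

Let trunc_cvg (x_ : nat -> R) (x : R) : 0 <= x -> x_ n @[n --> \oo] --> x ->
  \int[leb]_(u in `[0%R, +oo[) trunc n (x_ n) u @[n --> \oo] --> integrated_tail nu0 x.
Proof.
move=> x0 xx.
have mE : measurable_fun (`[0%R, +oo[%classic : set RR)
    (EFin \o (fun u : RR => expR (- x * u) * tail nu0 u)).
  by apply/measurable_EFinP; exact: measurable_exp_tail.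
have mT n : measurable_fun (`[0%R, +oo[%classic : set RR) (EFin \o (trunc n (x_ n) : RR -> R)).
  by apply/measurable_EFinP; exact: measurable_trunc.
have aeT : {ae leb, forall u, (`[0%R, +oo[%classic : set RR) u ->
    (EFin \o trunc n (x_ n)) u @[n --> \oo] --> (EFin \o (fun u => expR (- x * u) * tail nu0 u)) u}.
  have [N [mN N0 sN]] := ae_continuous_dist_fun nu0.
  exists N; split => // u /= h; apply: sN => /= cu; apply: h.
  rewrite in_itv/= andbT => u0.
  apply: cvg_EFin; first exact: nearW.
  (* Truncation does not affect the limit integrand, since the exponential factor is at most 1 on
     the half line. *)
  have -> : expR (- x * u) * tail nu0 u = Num.min (expR (- x * u) * tail nu0 u) (tail nu0 u).
    by apply/esym/min_idPl; exact: exp_tail_le.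
  apply: cvg_minl.
  apply: cvgM.
    apply: continuous_cvg; first exact: continuous_expR.
    by apply: cvgM; [exact: cvgN|exact: cvg_cst].
  rewrite dist_fun_tail; last exact: probability_setT.
  under eq_fun do rewrite dist_fun_tail//.
  by apply: cvgB; [exact: cvg_cst|exact: dist_fun_cvg].
have dom : {ae leb, forall u n, (`[0%R, +oo[%classic : set RR) u ->
    (`|(EFin \o trunc n (x_ n)) u| <= (EFin \o tail nu0) u)%E}.
  apply: aeW => u n _; rewrite /= lee_fin ger0_norm ?trunc_ge0//.
  by rewrite /trunc ge_min lexx orbT.
have [_ _ +] := @dominated_convergence _ RR R leb `[0%R, +oo[%classic
  (measurable_itv _) (fun n => EFin \o trunc n (x_ n))
  (EFin \o (fun u => expR (- x * u) * tail nu0 u)) (EFin \o tail nu0)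
  mT mE aeT (integrable_tail nu0oo hnu0 mnu0) dom.
move=> h; apply: fine_cvg; rewrite fineK; first exact: h.
by apply: integrable_fin_num => //; exact: integrable_exp_tail.
Qed.

Lemma integrated_tail_cvg (x_ : nat -> R) (x : R) : (forall n, 0 <= x_ n) ->
  x_ n @[n --> \oo] --> x ->
  integrated_tail (nu_ n) (x_ n) @[n --> \oo] --> integrated_tail nu0 x.
Proof.
move=> x_0 xx; have x0 : 0 <= x.
  by apply: (ler_cvg_to (cvg_cst 0) xx); exact: nearW.
have J := trunc_cvg x0 xx.
have c0 : (fun _ : nat => 0 : R) n @[n --> \oo] --> (0 : R) by exact: cvg_cst.
have J0 := trunc_cvg (lexx 0) c0.
have d0 : integrated_tail (nu_ n) 0 - \int[leb]_(u in `[0%R, +oo[) trunc n 0 u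
    @[n --> \oo] --> (0 : R).
  rewrite -[X in _ --> X](subrr (integrated_tail nu0 0)); apply: cvgB => //.
  rewrite integrated_tail0//; under eq_fun do rewrite integrated_tail0//.
  exact: mean_cvg.
(* The excess over the limit tail is largest without the exponential factor, so the excess at x_n
   lies between 0 and the excess at 0, which vanishes by [d0]. *)
have d1 : integrated_tail (nu_ n) (x_ n) - \int[leb]_(u in `[0%R, +oo[) trunc n (x_ n) u
    @[n --> \oo] --> (0 : R).
  apply: (squeeze_cvgr _ (cvg_cst 0) d0); apply: nearW => n.
  have iK y : 0 <= y -> leb.-integrable `[0%R, +oo[
    (EFin \o (fun u => expR (- y * u) * tail (nu_ n) u)) by exact: integrable_exp_tail.
  rewrite /integrated_tail -!RintegralB//; [|exact: iK|exact: iK].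
  have iB y : 0 <= y -> leb.-integrable `[0%R, +oo[
    (EFin \o (fun u => expR (- y * u) * tail (nu_ n) u - trunc n y u)).
    move=> y0; have := @integrableB _ _ _ leb _ (measurable_itv _) _ _
      (iK _ y0) (integrable_trunc n y).
    by apply: eq_integrable => // u _ /=; rewrite EFinB.
  apply/andP; split.
    by apply: Rintegral_ge0 => u _; rewrite subr_ge0 /trunc ge_min lexx.
  apply: le_Rintegral => //; [exact: iB|exact: iB|move=> u /=].
  rewrite in_itv/= andbT => u0.
  have := exp_tail_le (nu_ n) (x_0 n) u0.
  rewrite /trunc oppr0 mul0r expR0 mul1r.
  move: (expR _ * _) => a; rewrite /Order.min.
  by case: (ltP a _); case: (ltP (tail (nu_ n) u) _); lra.
rewrite -[X in _ --> X]add0r.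
apply: cvg_trans (cvgD d1 J); apply: near_eq_cvg; apply: nearW => n /=.
by rewrite subrK.
Qed.

End integrated_tail_cvg.

(** * The distribution of the hitting time *)

Section hitting_time.
Context {R : realType} {M : nat}.
Notation RR := (measurableTypeR R).
Context (d : measure_display) (Omega : measurableType d) (P : probability Omega R).
Variables (eta : nat -> Omega -> 'I_M) (kappa : nat -> Omega -> R).
Variable Q : 'I_M -> 'I_M -> {measure set RR -> \bar R}.
Hypothesis mrp : is_markov_renewal P eta kappa Q.
Variables (D : {set 'I_M}) (i : 'I_M).
Hypothesis hDi : (~: D)%SET = [set i]%SET.
Hypothesis init : (0 < P [set w | eta 0%N w = i])%E.

Let meta n j : measurable [set w | eta n w = j]. Proof. by case: mrp. Qed.
Let mkappa n : measurable_fun setT (kappa n : Omega -> RR). Proof. by case: mrp. Qed.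

Lemma kernel_half_line r j : on_half_line (Q r j).
Proof. by case: mrp => -[]. Qed.

Lemma kernel_lty r j : (Q r j setT < +oo)%E.
Proof.
case: mrp => -[_ /(_ r) Q1] _ _ _ _; apply: (@le_lt_trans _ _ 1%E); last exact: ltry.
by rewrite -Q1 (bigD1 j)//= leeDl// sume_ge0.
Qed.

Let stay n : set Omega := [set w | forall k, (k <= n)%N -> eta k w = i].
Let time n (w : Omega) : R := \sum_(1 <= k < n.+1) kappa k w.

(** The generating family of [history], named so that the generated sigma-algebra can be put on
    [Omega] and ordinary measurability lemmas used for it. *)
Let generators n : set (set Omega) :=
  [set A | exists2 k, (k <= n)%N &
    (exists j, A = [set w | eta k w = j]) \/
    (exists2 B : set RR, measurable B & A = kappa k @^-1` B)].

Let stayS n : stay n.+1 = stay n `&` [set w | eta n.+1 w = i].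
Proof.
apply/seteqP; split => [w h|w [h e] k].
  by split => [k kn|]; apply: h => //; exact: leqW.
by rewrite leq_eqVlt => /predU1P[->//|]; exact: h.
Qed.

Let stay0 : stay 0 = [set w | eta 0%N w = i].
Proof.
by apply/seteqP; split => [w h|w h k]; [exact: h|rewrite leqn0 => /eqP ->].
Qed.

Let timeS n w : time n.+1 w = time n w + kappa n.+1 w.
Proof. by rewrite /time big_nat_recr. Qed.

Let mstay n : measurable (stay n).
Proof.
elim: n => [|n ih]; first by rewrite stay0.
by rewrite stayS; exact: measurableI.
Qed.

Let mtime n : measurable_fun setT (time n : Omega -> RR).
Proof. by apply: measurable_sum => k; exact: mkappa. Qed.

Let history_stay n m : (m <= n)%N -> history eta kappa n (stay m).
Proof.
have g k : (k <= n)%N -> history eta kappa n [set w | eta k w = i].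
  by move=> kn; apply: sub_sigma_algebra; exists k => //; left; exists i.
elim: m => [|m ih] mn; first by rewrite stay0; exact: g.
rewrite stayS; apply: (@measurableI _ (g_sigma_algebraType (generators n))).
  exact: (ih (ltnW mn)).
exact: g.
Qed.

Let history_time n (B : set RR) : measurable B -> history eta kappa n (time n @^-1` B).
Proof.
move=> mB.
have mk k : (k <= n)%N ->
    measurable_fun setT (kappa k : g_sigma_algebraType (generators n) -> RR).
  move=> kn _ C mC; rewrite setTI; apply: sub_sigma_algebra.
  by exists k => //; right; exists C.
have mt m : (m <= n)%N ->
    measurable_fun setT (time m : g_sigma_algebraType (generators n) -> RR).
  elim: m => [_|m ih mn].
    rewrite (_ : time 0 = cst 0)//.
    by apply/funext => w; rewrite /time big_geq.
  rewrite (_ : time m.+1 = fun w => time m w + kappa m.+1 w); last first.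
    by apply/funext => w; rewrite timeS.
  by apply: measurable_funD; [exact: (ih (ltnW mn))|exact: mk].
by have := mt n (leqnn n) measurableT B mB; rewrite setTI.
Qed.

Let c : R := fine (P [set w | eta 0%N w = i]).

Let PcE : P [set w | eta 0%N w = i] = c%:E.
Proof. by rewrite fineK// fin_num_measure. Qed.

Let c0 : 0 < c.
Proof. by rewrite -lte_fin -PcE. Qed.

Let cV0 : 0 <= c^-1.
Proof. by rewrite invr_ge0 ltW. Qed.

Definition kernel_measure r j : {finite_measure set RR -> \bar R} :=
  finite_measure_of (kernel_lty r j).

Let Qii := kernel_measure i i.

(** Both sides are finite measures in B, and for rays B the identity is the Markov property applied
    to the history event on which the chain has stayed in i with elapsed time in A. *)
Let step n j (A B : set RR) : measurable A -> measurable B ->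
  P (stay n `&` [set w | eta n.+1 w = j] `&` time n @^-1` A `&` kappa n.+1 @^-1` B) =
  (P (stay n `&` time n @^-1` A) * Q i j B)%E.
Proof.
move=> mA mB.
have mtA : measurable (time n @^-1` A).
  by rewrite -[X in measurable X]setTI; exact: mtime.
have mE : measurable (stay n `&` [set w | eta n.+1 w = j] `&` time n @^-1` A).
  by apply: measurableI => //; exact: measurableI.
have mSA : measurable (stay n `&` time n @^-1` A) by exact: measurableI.
pose m1 := image_measure (mrestr P mE) (mkappa n.+1).
have q0 : 0 <= fine (P (stay n `&` time n @^-1` A)) by rewrite fine_ge0.
pose m2 : {measure set RR -> \bar R} := mscale (NngNum q0) (Q i j).
have -> : P (stay n `&` [set w | eta n.+1 w = j] `&` time n @^-1` A `&`
             kappa n.+1 @^-1` B) = m1 B.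
  by rewrite -[RHS]/(P (_ `&` _)) setIC.
have -> : (P (stay n `&` time n @^-1` A) * Q i j B)%E = m2 B.
  by rewrite -[RHS]/(_ * _)%E /= fineK// fin_num_measure.
apply: measure_eq_rays => //.
  apply: (@le_lt_trans _ _ 1%E); last exact: ltry.
  rewrite -[leLHS]/(P (_ `&` _)); apply: probability_le1.
  by rewrite preimage_setT setTI.
move=> t.
rewrite -[RHS]/(_ * _)%E /= fineK ?fin_num_measure//.
rewrite -[LHS]/(P (kappa n.+1 @^-1` _ `&` _)).
have hA : history eta kappa n (stay n `&` time n @^-1` A).
  apply: (@measurableI _ (g_sigma_algebraType (generators n))).
    exact: history_stay.
  exact: history_time.
have hs : (stay n `&` time n @^-1` A) `&` [set w | eta n w = i] =
    stay n `&` time n @^-1` A.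
  by apply/setIidPl => w [h _]; exact: h.
case: mrp => _ _ _ _ /(_ n _ i j t hA); rewrite hs => <-; congr (P _).
apply/seteqP; split => w /=; rewrite in_itv/=.
  by move=> [? [[? ?] ?]].
by move=> [[? ?] [? ?]].
Qed.

(** [step] gives the identity on rectangles, which determine the product measure. The law of
    [time n] is a premise because [law] calls this result inside its own induction. *)
Let joint n j (X : set (RR * RR)) : measurable X ->
  (forall A : set RR, measurable A -> P (stay n `&` time n @^-1` A) = (c%:E * conv_pow Qii n A)%E) ->
  P (stay n `&` [set w | eta n.+1 w = j] `&`
     (fun w => (time n w, kappa n.+1 w)) @^-1` X) =
  (c%:E * (conv_pow Qii n \x kernel_measure i j) X)%E.
Proof.
move=> mX IH.
have mE : measurable (stay n `&` [set w | eta n.+1 w = j]) by exact: measurableI.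
have mp : measurable_fun setT (fun w => (time n w, kappa n.+1 w) : RR * RR).
  by apply: measurable_fun_pair; [exact: mtime|exact: mkappa].
pose m := image_measure (mrestr P mE) mp.
(* Dividing by the probability [c] of starting in i makes the two measures agree exactly on
   rectangles. *)
pose m' : {measure set (RR * RR) -> \bar R} := mscale (NngNum cV0) m.
rewrite (@product_measure_unique _ _ _ _ _ (conv_pow Qii n) (kernel_measure i j) m')//.
  rewrite -[in RHS]/(_ * _)%E /= muleA -EFinM mulfV ?gt_eqF// mul1e.
  by rewrite -[RHS]/(P (_ `&` _)) setIC.
move=> A B mA mB; rewrite -[LHS]/(_ * P (_ `&` _))%E /=.
transitivity ((c^-1)%:E * (c%:E * conv_pow Qii n A * Q i j B))%E.
  rewrite -IH// -step//; congr (_ * P _)%E.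
  apply/seteqP; split => w /=.
    by move=> [[? ?] [? ?]].
  by move=> [[[? ?] ?] ?].
by rewrite muleA muleA -EFinM mulVf ?gt_eqF// mul1e.
Qed.

Let add (z : RR * RR) : RR := z.1 + z.2.

Let law n (A : set RR) : measurable A ->
  P (stay n `&` time n @^-1` A) = (c%:E * conv_pow Qii n A)%E.
Proof.
elim: n A => [|n ih] A mA.
  rewrite stay0 /= diracE (_ : time 0 @^-1` A = if 0 \in A then setT else set0).
    case: ifPn => _; first by rewrite setIT PcE mule1.
    by rewrite setI0 measure0 mule0.
  have t0 w : time 0 w = 0 by rewrite /time big_geq.
  apply/seteqP; split => w /=; rewrite t0.
    by move=> /mem_set ->.
  by case: ifPn => // /set_mem.
rewrite [RHS](_ : _ = (c%:E * (conv_pow Qii n \x Qii)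
    (add @^-1` A))%E)//.
rewrite -joint//.
  rewrite stayS; congr (P (_ `&` _)).
  by apply/seteqP; split => w /=; rewrite timeS.
by rewrite -[X in measurable X]setTI; exact: measurable_addTR.
Qed.

Let exit n j (A : set RR) : measurable A ->
  P (stay n `&` [set w | eta n.+1 w = j] `&` time n.+1 @^-1` A) =
  (c%:E * convolution (conv_pow Qii n) (kernel_measure i j) A)%E.
Proof.
move=> mA; rewrite [RHS](_ : _ = (c%:E * (conv_pow Qii n \x kernel_measure i j)
    (add @^-1` A))%E)//.
rewrite -joint//; last exact: law.
  congr (P (_ `&` _)).
  by apply/seteqP; split => w /=; rewrite timeS.
by rewrite -[X in measurable X]setTI; exact: measurable_addTR.
Qed.

Let notinD k : (k \in D) = (k != i).
Proof.
have : (k \in (~: D)%SET) = (k == i) by rewrite hDi finset.in_set1.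
by rewrite finset.in_setC => <-; rewrite negbK.
Qed.

Let hit_index_exit n j w : j \in D -> stay n w -> eta n.+1 w = j ->
  hit_index eta D w = Some n.+1.
Proof.
move=> jD sw ew; rewrite /hit_index; case: pselect => [h|]; last first.
  by case; exists n.+1; rewrite ew.
case: ex_minnP => m /andP[m0 mD] mmin; congr Some; apply/eqP.
rewrite eqn_leq mmin ?ew// ltnNge; apply/negP => mn.
by move: mD; rewrite sw// notinD eqxx.
Qed.

Let hit_index_stay m w : eta 0%N w = i -> hit_index eta D w = Some m ->
  [/\ (0 < m)%N & stay m.-1 w].
Proof.
move=> e0; rewrite /hit_index; case: pselect => // h.
case: ex_minnP => k /andP[k0 kD] kmin [<-]; split => // l lk.
(* Hits are counted from index 1, so minimality says nothing about index 0; the initial condition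
   does. *)
have [->//|l0] := eqVneq l 0%N; apply/eqP/negPn/negP; rewrite -notinD => lD.
have := kmin l; rewrite lt0n l0 lD => /(_ isT); rewrite leqNgt => /negP; apply.
by rewrite -(prednK k0) ltnS.
Qed.

(** Since i is the only state outside [D], hitting at j by time t is the disjoint union over n of
    staying in i up to index n and jumping to j at n + 1. Each piece is given by [exit], and
    conditioning removes [c]. *)
Lemma hit_df_renewal j t : j \in D ->
  hit_df P eta kappa D i j t =
  dist_fun (renewal (kernel_measure i j) (kernel_measure i i)) t.
Proof.
move=> jD; rewrite /hit_df /cond_prob.
pose F n := stay n `&` [set w | eta n.+1 w = j] `&` time n.+1 @^-1` `]-oo, t]%classic.
have -> : [set w | (hit_time eta kappa D w <= t%:E)%E /\ hit_state eta D w = Some j] `&`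
    [set w | eta 0%N w = i] = \bigcup_n F n.
  apply/seteqP; split => w /=.
    rewrite /hit_time /hit_state => -[[]].
    case E : (hit_index eta D w) => [m|//] /=; rewrite lee_fin => ht [ej] e0.
    have [m0 sm] := hit_index_stay e0 E.
    exists m.-1 => //; rewrite /F.
    by split; [split|] => //=; rewrite (prednK m0)// in_itv.
  move=> [n _ [[sw ew]]] /=; rewrite in_itv/= => tw.
  have E := hit_index_exit jD sw ew.
  split; last exact: sw.
  by rewrite /hit_time /hit_state E /= lee_fin ew.
have mF n : measurable (F n).
  apply: measurableI; first exact: measurableI.
  by rewrite -[X in measurable X]setTI; exact: mtime.
have tF : trivIset setT F.
  apply/trivIsetP => n m _ _; wlog nm : n m / (n < m)%N => [wl|_].
    by rewrite neq_ltn => /orP[nm|nm]; [|rewrite setIC]; apply: wl => //; rewrite ltn_eqF.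
  rewrite -subset0 => w [[[_ ew] _] [[sw _] _]].
  by move: jD; rewrite -(ew : eta n.+1 w = j) sw// notinD eqxx.
rewrite -/c /dist_fun; set X := renewal _ _ _.
have PX : P (\bigcup_n F n) = (c%:E * X)%E.
  rewrite measure_bigcup// (eq_eseriesl (Q := xpredT)); last first.
    by move=> n; rewrite in_setT.
  rewrite /X /= /mseries -nneseriesZl//.
  by apply: eq_eseriesr => n _; rewrite exit.
(* Finiteness of the probability excludes infinite values of [X], for which [fine] would not commute
   with the division by [c]. *)
have : P (\bigcup_n F n) \is a fin_num.
  by rewrite fin_num_measure//; exact: bigcup_measurable.
rewrite PX; case: X {PX} => [x|/=|/=]; first by rewrite /= mulrAC mulfV ?mul1r ?gt_eqF.
- by rewrite gt0_muley ?lte_fin.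
- by rewrite gt0_muleNy ?lte_fin.
Qed.

End hitting_time.

(** * The limit *)

Section finite_half_line.
Context {R : realType}.
Notation RR := (measurableTypeR R).
Implicit Types A B : {measure set RR -> \bar R}.

Lemma laplace_le_mass A s : on_half_line A -> (A setT < +oo)%E -> 0 <= s ->
  0 <= laplace A s <= total_mass A.
Proof.
move=> hA Aoo s0; rewrite laplaceE fine_ge0 ?elaplace_ge0//=.
apply: fine_le; [exact: elaplace_fin|by rewrite ge0_fin_numE|exact: elaplace_le].
Qed.

Lemma laplace_scaled A c s : 0 < c -> laplace (scaled A c) s = laplace A (s * c).
Proof. by move=> c0; rewrite !laplaceE elaplace_scaled. Qed.

Lemma laplace0 A : on_half_line A -> laplace A 0 = total_mass A.
Proof. by move=> hA; rewrite laplaceE elaplace0. Qed.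

Lemma total_mass_probability (F : probability RR R) : total_mass F = 1.
Proof. exact: (congr1 fine (probability_setT F)). Qed.

Lemma normalized_half_line A : on_half_line A -> on_half_line (normalized A).
Proof. exact: mscale_half_line. Qed.

Lemma normalized_setT A : (A setT < +oo)%E -> 0 < total_mass A -> normalized A setT = 1%E.
Proof.
move=> Aoo A0; rewrite -[LHS]/(_ * _)%E /= -[A setT]fineK ?ge0_fin_numE//.
by rewrite -EFinM mulVf// gt_eqF.
Qed.

(** Stated as a product so as to survive mass 0, where [normalized] is the zero measure: the
    transform of [A] lies between 0 and its mass, so both sides vanish. *)
Lemma laplace_normalized A s : on_half_line A -> (A setT < +oo)%E -> 0 <= s ->
  total_mass A * laplace (normalized A) s = laplace A s.
Proof.
move=> hA Aoo s0; rewrite [laplace (normalized A) s]laplaceE elaplace_mscale.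
rewrite fineM ?elaplace_fin//= mulrA -laplaceE.
have [A0|A0] := eqVneq (total_mass A) 0; last by rewrite mulfV// mul1r.
have := laplace_le_mass hA Aoo s0; rewrite A0 -eq_le => /eqP <-.
by rewrite mulr0.
Qed.

Lemma dist_fun_cvg_total_mass A : (A setT < +oo)%E ->
  dist_fun A t @[t --> +oo] --> total_mass A.
Proof.
move=> Aoo.
have fA (B : set RR) : measurable B -> A B \is a fin_num.
  by move=> mB; rewrite ge0_fin_numE// (le_lt_trans _ Aoo)// le_measure ?inE.
have cn : dist_fun A n%:R @[n --> \oo] --> total_mass A.
  apply: fine_cvg; rewrite fineK ?fA//.
  have -> : [set: RR] = \bigcup_n `]-oo, n%:R]%classic.
    apply/esym; rewrite -subTset => t _/=.
    by exists (Num.truncn t).+1; rewrite //= in_itv/= ltW// truncnS_gt.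
  apply: (@nondecreasing_cvg_mu _ _ _ A (fun n => `]-oo, n%:R]%classic)) => //.
  - exact: bigcup_measurable.
  - move=> n m nm; apply/subsetPset => x/=; rewrite !in_itv/= => /le_trans.
    by apply; rewrite ler_nat.
have leA t : dist_fun A t <= total_mass A.
  by apply: fine_le; [exact: fA|exact: fA|apply: le_measure; rewrite ?inE].
apply/cvgrPdist_le => e e0.
move/cvgrPdist_le : cn => /(_ _ e0) [N _ /(_ N (leqnn N)) /= hN].
near=> t; have tN : N%:R <= t by near: t; exact: nbhs_pinfty_ge.
apply: le_trans hN; rewrite !ger0_norm ?subr_ge0// lerD2l lerN2.
exact: dist_fun_le.
Unshelve. all: by end_near. Qed.

(** A null mean would put all the mass at 0. This makes the limiting exponential law of the case
    p_{0,ii} = 1 nondegenerate. *)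
Lemma mean_gt0 A : on_half_line A -> dist_fun A 0 < total_mass A -> (0 < mean A)%E.
Proof.
move=> hA A0; rewrite lt0e; apply/andP; split; last first.
  by apply: integral_ge0 => t /=; rewrite in_itv/= andbT lee_fin.
apply/negP => /eqP m0.
suff : dist_fun A 0 = total_mass A
  by move: A0 => /[swap] ->; rewrite ltxx.
have ae0 : @ae_eq _ RR R A (fun=> \bar R) `[0%R, +oo[%classic (fun t => t%:E) (cst 0%E).
  apply/ae_eq_integral_abs => //.
    by apply/measurable_EFinP; exact: measurable_id.
  by rewrite -[RHS]m0; apply: eq_integral => t; rewrite inE/= in_itv/= andbT => t0;
    rewrite ger0_norm.
have [N [mN N0 sN]] := ae0.
have A00 : A `]0%R, +oo[%classic = 0%E.
  apply: (subset_measure0 _ _ _ N0) => //.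
  move=> t /=; rewrite in_itv/= andbT => t0; apply: sN => /=.
  rewrite in_itv/= andbT ltW// => /(_ isT) [] /eqP; rewrite gt_eqF//.
rewrite /dist_fun /total_mass; congr fine.
have -> : [set: RR] = `]-oo, 0%R]%classic `|` `]0%R, +oo[%classic.
  apply/esym; rewrite -subTset => t _ /=; rewrite !in_itv/= andbT.
  by have [|] := leP t 0; [left|right].
rewrite measureU//; first by rewrite [X in (_ + X)%E]A00 adde0.
rewrite -subset0 => t /=; rewrite !in_itv/= andbT => -[].
by rewrite leNgt => /negP.
Qed.

(* With d = 1 - p and phi_B(d s) = 1 - d s K, the denominator 1 - p phi_B is
   d (1 + p s K), which cancels the normalisation by d. *)
Lemma laplace_scaled_renewal A B (Aoo : (A setT < +oo)%E) (Boo : (B setT < +oo)%E)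
    (v s K : R) : on_half_line A -> on_half_line B ->
  total_mass B < 1 -> 0 < v -> 0 <= s -> 0 <= K ->
  let p := total_mass B in
  p * laplace (scaled (normalized B) v^-1) ((1 - p) * s) = p * (1 - (1 - p) * s * K) ->
  laplace (scaled (renewal (finite_measure_of Aoo) (finite_measure_of Boo))
             ((1 - p)^-1 * v)^-1) s =
  total_mass A / (1 - p) * laplace (scaled (normalized A) v^-1) ((1 - p) * s) /
    (1 + p * s * K).
Proof.
move=> hA hB B1 v0 s0 K0 p hp.
have p0 : 0 <= p by rewrite fine_ge0.
have d0 : 0 < 1 - p by rewrite subr_gt0.
have tv0 : 0 < ((1 - p)^-1 * v)^-1 by rewrite invr_gt0 mulr_gt0// invr_gt0.
have x0 : 0 <= (1 - p) * s * v^-1 by rewrite !mulr_ge0 ?invr_ge0// ltW.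
have xE : s * ((1 - p)^-1 * v)^-1 = (1 - p) * s * v^-1.
  by rewrite invfM invrK; ring.
have LA : laplace A ((1 - p) * s * v^-1) =
    total_mass A * laplace (scaled (normalized A) v^-1) ((1 - p) * s).
  by rewrite laplace_scaled ?invr_gt0// laplace_normalized.
have LB : laplace B ((1 - p) * s * v^-1) = p * (1 - (1 - p) * s * K).
  by rewrite -hp laplace_scaled ?invr_gt0// laplace_normalized.
have LB1 : laplace B ((1 - p) * s * v^-1) < 1.
  by have /andP[_ /le_lt_trans] := laplace_le_mass hB Boo x0; apply.
rewrite laplace_scaled// xE laplaceE elaplace_renewal//=.
rewrite -[laplace (finite_measure_of Aoo) _]/(laplace A _).
rewrite -[laplace (finite_measure_of Boo) _]/(laplace B _).
rewrite LA LB; field.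
have psK : 0 <= p * s * K by rewrite !mulr_ge0.
by rewrite !gt_eqF//; nra.
Qed.

End finite_half_line.

(** * Existence of the limit laws *)

Section probability_of.
Context d (T : measurableType d) (R : realType).
Variables (mu : {measure set T -> \bar R}) (h : mu setT = 1%E).

Definition probability_alias of mu setT = 1%E : set T -> \bar R := mu.

HB.instance Definition _ := Measure.on (probability_alias h).
HB.instance Definition _ :=
  @Measure_isProbability.Build d T R (probability_alias h) h.

Definition probability_of : probability T R := probability_alias h.

End probability_of.

Section existence.
Context {R : realType}.
Notation RR := (measurableTypeR R).
Notation leb := (@lebesgue_measure R).

(** The law is that of 1 - p times a sum of N terms drawn from [B] and one from [A], with N
    geometric of parameter p: a renewal measure with weights p and 1 - p, whose mass is (1 - p)/(1 -
    p). *)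
Lemma geometric_sum_exists (p : R) (A B : probability RR R) : 0 <= p < 1 ->
  on_half_line A -> on_half_line B ->
  exists F : probability RR R, on_half_line F /\ forall s, 0 <= s ->
    laplace F s = (1 - p) * laplace A ((1 - p) * s) / (1 - p * laplace B ((1 - p) * s)).
Proof.
move=> /andP[p0 p1] hA hB.
have q0 : 0 < 1 - p by rewrite subr_gt0.
pose mA : {finite_measure set RR -> \bar R} := mscale (NngNum (ltW q0)) A.
pose mB : {finite_measure set RR -> \bar R} := mscale (NngNum p0) B.
have hmA : on_half_line mA by exact: mscale_half_line.
have hmB : on_half_line mB by exact: mscale_half_line.
have oo (C : probability RR R) : (C setT < +oo)%E by rewrite probability_setT ltry.
have L (C : probability RR R) (k : {nonneg R}) s : on_half_line C -> 0 <= s ->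
    laplace (mscale k C) s = k%:num * laplace C s.
  by move=> hC s0; rewrite laplaceE elaplace_mscale fineM//; apply: elaplace_fin => //; exact: oo.
have tm (C : probability RR R) (k : {nonneg R}) : total_mass (mscale k C) = k%:num.
  rewrite /total_mass -[X in fine X]/(_ * _)%E /=.
  by rewrite (_ : C _ = 1%E) ?mule1//; exact: probability_setT.
have tA : total_mass mA = 1 - p by exact: tm.
have tB : total_mass mB = p by exact: tm.
have r1 : scaled (renewal mA mB) (1 - p) setT = 1%E.
  rewrite scaled_setT renewal_setT// ?tB// tA mulfV// gt_eqF//.
exists (probability_of r1); split.
  by apply: (scaled_half_line q0); exact: renewal_half_line.
move=> s s0; rewrite -[LHS]/(laplace (scaled _ _) _) laplace_scaled//.
have s1 : 0 <= s * (1 - p) by rewrite mulr_ge0// ltW.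
have LB : laplace mB (s * (1 - p)) = p * laplace B (s * (1 - p)) by exact: L.
have LA : laplace mA (s * (1 - p)) = (1 - p) * laplace A (s * (1 - p)) by exact: L.
have lB := laplace_le_mass hmB (finite_measure_lty mB) s1.
rewrite laplaceE elaplace_renewal//=; last first.
  by move: lB => /andP[_ /le_lt_trans]; apply; rewrite tB.
by rewrite LA LB (mulrC s).
Qed.

Definition exponential_probability (r : R) (r0 : 0 < r) : probability RR R.
Proof. refine (exponential_prob r : probability RR R); exact r0. Defined.

Lemma integral_exp_half_line (q : R) : 0 < q ->
  (\int[leb]_(u in `[0%R, +oo[) (expR (- q * u))%:E = (q^-1)%:E)%E.
Proof.
move=> q0; have := integral_exponential_pdf q0.
rewrite (_ : (\int[leb]_x _)%E =
    (\int[leb]_(u in `[0%R, +oo[) (q * expR (- q * u))%:E)%E); last first.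
  rewrite [RHS]integral_mkcond; apply: eq_integral => u _.
  by rewrite /exponential_pdf !patchE; case: ifP.
under eq_integral do rewrite EFinM.
rewrite ge0_integralZl//; last 2 first.
- exact: measurable_EFin_expM.
- by rewrite lee_fin ltW.
move=> h; rewrite -[LHS]mul1e (_ : 1%E = ((q^-1)%:E * q%:E)%E); last first.
  by rewrite -EFinM mulVf// gt_eqF.
by rewrite -muleA h mule1.
Qed.

Lemma exponential_half_line (r : R) (r0 : 0 < r) : on_half_line (exponential_probability r0).
Proof.
rewrite /on_half_line -[LHS]/(integral _ _ _) integral0_eq// => x /=.
by rewrite in_itv/= => x0; rewrite lt0_exponential_pdf.
Qed.

Lemma exponential_tail (r u : R) (r0 : 0 < r) : 0 <= u ->
  tail (exponential_probability r0) u = expR (- r * u).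
Proof.
move=> u0; set F := exponential_probability r0.
have hF : on_half_line F by exact: exponential_half_line.
rewrite dist_fun_tail; last exact: probability_setT.
suff -> : dist_fun F u = 1 - expR (- r * u) by rewrite opprB addrC subrK.
have -> : dist_fun F u = fine (F `[0%R, u]%classic).
  congr fine.
  have -> : `]-oo, u]%classic = `]-oo, 0%R[%classic `|` `[0%R, u]%classic :> set RR.
    apply/seteqP; split => x /=; rewrite !in_itv/=.
      by move=> xu; have [|] := ltP x 0; [left|right].
    by case=> [/ltW /le_trans|/andP[]//]; apply.
  rewrite measureU//; first by rewrite [X in (X + _)%E]hF add0e.
  rewrite -subset0 => x /=; rewrite !in_itv/= => -[+ /andP[]].
  by rewrite ltNge => /negP.
move: u0; rewrite le_eqVlt => /predU1P[<-|u0].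
  rewrite mulr0 expR0 subrr set_itv1 -[X in fine X]/(integral _ _ _).
  by rewrite integral_set1.
by rewrite -[X in fine X]/(exponential_prob r _) exponential_prob_itv0c.
Qed.

(** For the exponential law of mean m the tail is exp(-u/m), hence K(s) = 1/(s + 1/m) and 1 - s K(s)
    = 1/(1 + ms). *)
Lemma exponential_exists (m : R) : 0 < m ->
  exists F : probability RR R, on_half_line F /\ forall s, 0 <= s ->
    laplace F s = 1 / (1 + m * s).
Proof.
move=> m0; have r0 : 0 < m^-1 by rewrite invr_gt0.
pose F := exponential_probability r0; exists F.
have hF : on_half_line F by exact: exponential_half_line.
have Foo : (F setT < +oo)%E.
  by apply: (@le_lt_trans _ _ 1%E); [exact: probability_le1|exact: ltry].
split => // s s0.
have mF : (mean F < +oo)%E.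
  rewrite -mean_tail// (eq_integral (fun u : RR => (expR (- m^-1 * u))%:E)); last first.
    by move=> u; rewrite inE/= in_itv/= andbT => u0; rewrite exponential_tail.
  by rewrite integral_exp_half_line// ltry.
have := laplace_integrated_tail Foo hF mF s0.
have -> : integrated_tail F s = (s + m^-1)^-1.
  rewrite /integrated_tail /Rintegral.
  rewrite (eq_integral (fun u : RR => (expR (- (s + m^-1) * u))%:E)); last first.
    move=> u; rewrite inE/= in_itv/= andbT => u0; rewrite exponential_tail//.
    by rewrite -expRD opprD mulrDl.
  by rewrite integral_exp_half_line// ltr_wpDl.
rewrite laplace0// total_mass_probability.
move=> /= h; have -> : laplace F s = 1 - s * (s + m^-1)^-1 by rewrite h; ring.
have ms : 0 <= m * s by rewrite mulr_ge0// ltW.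
by field; rewrite !gt_eqF//; lra.
Qed.

End existence.

(** * Right limits at 0 along sequences in ]0, 1] *)

Section sequential_limit.
Context {R : realType}.

(** A positive sequence tending to 0 is replaced by its minimum with 1, which eventually coincides
    with it. *)
Lemma cvg_at_right01 (f : R -> R) (l : R) :
  (forall u : nat -> R, (forall n, 0 < u n <= 1) -> u n @[n --> \oo] --> (0 : R) ->
    f (u n) @[n --> \oo] --> l) -> f e @[e --> 0^'+] --> l.
Proof.
move=> h; apply/cvg_at_rightP => u [u0 uc].
have c := cvg_minl (c := 1) uc; rewrite min_l// in c.
have /h /(_ c) : forall n, 0 < Num.min (u n) 1 <= 1.
  by move=> n; rewrite lt_min u0 ltr01 ge_min lexx orbT.
apply: cvg_trans; apply: near_eq_cvg.
have : \forall n \near \oo, u n <= 1.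
  by apply: (cvgr_le _ uc); exact: ltr01.
by apply: filterS => n /min_l ->.
Qed.

Lemma cvg_at_right_seq (f : R -> R) (l : R) (u : nat -> R) :
  f e @[e --> 0^'+] --> l -> (forall n, 0 < u n <= 1) -> u n @[n --> \oo] --> (0 : R) ->
  f (u n) @[n --> \oo] --> l.
Proof.
move=> /cvg_at_rightP h u0 uc; apply: h; split => // n.
by have /andP[] := u0 n.
Qed.

End sequential_limit.

(** The limit laws are characterised by their transforms and quantified over; the existence clause
    keeps the convergence clause from being vacuous. *)
Theorem theorem1
  (R : realType) (M : nat) (hM : (2 <= M)%N)
  (D : {set 'I_M}) (hD0 : D != finset.set0) (hDT : D \proper [set: 'I_M]%SET)
  (i : 'I_M) (hDi : (~: D)%SET = [set i]%SET)
  (* the Markov renewal processes, for e in ]0, 1] *)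
  (d : R -> measure_display) (Omega : forall e : R, measurableType (d e))
  (P : forall e : R, probability (Omega e) R)
  (eta : forall e : R, nat -> Omega e -> 'I_M)
  (kappa : forall e : R, nat -> Omega e -> R)
  (Q : R -> 'I_M -> 'I_M -> {measure set (measurableTypeR R) -> \bar R})
  (hMRP : forall e, 0 < e <= 1 ->
     is_markov_renewal (P e) (eta e) (kappa e) (Q e))
  (* the conditional probabilities given eta_{e,0} = i are defined *)
  (hinit : forall e, 0 < e <= 1 -> (0 < P e [set w | eta e 0%N w = i])%E)
  (v : R -> R) (hv : forall e, 0 < e <= 1 -> 1 <= v e)
  (hA : forall (r : 'I_M) e, 0 < e <= 1 -> sojourn_df (Q e) r 0 < 1)
  (hB1 : forall j : 'I_M,
     (forall e, 0 < e <= 1 -> 0 < trans_prob (Q e) i j) \/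
     (forall e, 0 < e <= 1 -> trans_prob (Q e) i j = 0))
  (hB2 : exists (n : nat) (c : nat -> 'I_M),
     [/\ c 0%N = i,
         forall l, (0 < l < n)%N -> c l \in (~: D)%SET,
         c n \in D
       & 0 < \prod_(1 <= l < n.+1) trans_prob (Q 1) (c l.-1) (c l)])
  (p0 : 'I_M -> R)
  (hC : forall j : 'I_M, trans_prob (Q e) i j @[e --> 0^'+] --> p0 j)
  (F0 : 'I_M -> probability (measurableTypeR R) R)
  (hD1 : forall j : 'I_M, j \in Yset Q i ->
     [/\ weak_cvg (fun e => dist_fun (cond_sojourn (Q e) i j)) v
           (dist_fun (F0 j)),
         on_half_line (F0 j)
       & dist_fun (F0 j) 0 < 1])
  (v0 : \bar R) (hv0 : (1 <= v0)%E)
  (hD2 : (v e)%:E @[e --> 0^'+] --> v0)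
  (hE1 : forall j : 'I_M, j \in Yset Q i -> forall e, 0 < e <= 1 ->
     (mean (cond_sojourn (Q e) i j) < +oo)%E)
  (hE2 : forall j : 'I_M, j \in Yset Q i -> (mean (F0 j) < +oo)%E)
  (hE3 : forall j : 'I_M, j \in Yset Q i ->
     fine (mean (cond_sojourn (Q e) i j)) / v e @[e --> 0^'+] -->
     fine (mean (F0 j)))
  (tp0 : 'I_M -> R) (htp0 : forall j : 'I_M, 0 <= tp0 j <= 1)
  (htC : forall j : 'I_M,
     tilde_trans_prob (Q e) i j @[e --> 0^'+] --> tp0 j) :
  let tv (e : R) : R := (1 - trans_prob (Q e) i i)^-1 * v e in
  let is_tF0 (j : 'I_M) (F : probability (measurableTypeR R) R) : Prop :=
    on_half_line F /\
    forall s : R, 0 <= s -> laplace F s = tilde_laplace i (Yset Q i) p0 F0 j s in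
  (* the distribution functions tF0 exist *)
  (forall j : 'I_M, j \in Yset Q i -> j != i -> exists F, is_tF0 j F) /\
  (forall tF0 : 'I_M -> probability (measurableTypeR R) R,
     (forall j : 'I_M, j \in Yset Q i -> j != i -> is_tF0 j (tF0 j)) ->
     forall j : 'I_M, j \in D ->
       weak_cvg (fun e => hit_df (P e) (eta e) (kappa e) D i j) tv
         (fun t => if j \in Yset Q i then dist_fun (tF0 j) t * tp0 j else 0)).
Proof.
move=> tv is_tF0.
have notinD k : (k \in D) = (k != i).
  have : (k \in (~: D)%SET) = (k == i) by rewrite hDi finset.in_set1.
  by rewrite finset.in_setC => <-; rewrite negbK.
have e1 : 0 < (1 : R) <= 1 by rewrite ltr01 lexx.
have hQ e he r k := @kernel_half_line R M _ _ (P e) _ _ _ (hMRP e he) r k.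
have Qoo e he r k := @kernel_lty R M _ _ (P e) _ _ _ (hMRP e he) r k.
have tp_ge0 e r k : 0 <= trans_prob (Q e) r k by rewrite fine_ge0.
have inY k : (k \in Yset Q i) = (0 < trans_prob (Q 1) i k) by rewrite finset.inE.
have posY k e : k \in Yset Q i -> 0 < e <= 1 -> 0 < trans_prob (Q e) i k.
  rewrite inY => k1 he; case: (hB1 k) => [|/(_ _ e1) k0]; first exact.
  by move: k1; rewrite k0 ltxx.
have zeroY k e : k \notin Yset Q i -> 0 < e <= 1 -> trans_prob (Q e) i k = 0.
  by rewrite inY => /negP k1 he; case: (hB1 k) => [/(_ _ e1)|]; last exact.
(* The last jump of the chain in (B) leaves i, the only state outside [D]. Its target k has positive
   probability for every e, which forces p_{e,ii} < 1. *)
have [k kY kD] : exists2 k, k \in Yset Q i & k \in D.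
  have [n [c [ci cD cn]]] := hB2.
  case: n cD cn => [_|n cD cn]; first by rewrite ci notinD eqxx.
  rewrite big_nat_recr//= => pr; exists (c n.+1) => //; rewrite inY.
  have -> : i = c n.
    case: n cD {cn pr} => [|n] cD; first by rewrite ci.
    by have := cD n.+1; rewrite ltnSn => /(_ isT); rewrite hDi finset.in_set1 => /eqP.
  rewrite lt_def tp_ge0 andbT; apply/eqP => h0.
  by move: pr; rewrite h0 mulr0 ltxx.
have ki : k != i by rewrite -notinD.
have pii_lt1 e : 0 < e <= 1 -> total_mass (Q e i i) < 1.
  move=> he; have kpos := posY _ _ kY he.
  have [[_ Q1] _ _ _ _] := hMRP _ he; move: {Q1}(Q1 i).
  rewrite (bigD1 i)//= (bigD1 k)//= => Q1.
  have : (Q e i i setT + Q e i k setT <= 1)%E.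
    by rewrite -Q1 leeD2l// leeDl// sume_ge0.
  rewrite -(@fineK _ (Q e i i setT)) ?ge0_fin_numE ?Qoo//.
  rewrite -(@fineK _ (Q e i k setT)) ?ge0_fin_numE ?Qoo//.
  rewrite -EFinD lee_fin -/(total_mass (Q e i i)) -/(total_mass (Q e i k)) => h.
  have k0 : 0 < total_mass (Q e i k) := kpos.
  by lra.
(* A concrete sequence along which the bounds 0 <= p_{e,ii} <= 1 pass to the limit. *)
have seq01 : exists2 u : nat -> R, (forall n, 0 < u n <= 1) & u n @[n --> \oo] --> (0 : R).
  exists (fun n => n.+1%:R^-1) => [n|].
    by rewrite invr_gt0 ltr0n/= invf_le1 ?ltr0n// ler1n.
  exact: (@cvg_harmonic R).
have [u1 hu1 uc1] := seq01.
have p0_ge0 : 0 <= p0 i.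
  apply: (ler_cvg_to (cvg_cst 0) (cvg_at_right_seq (hC i) hu1 uc1)).
  by apply: nearW => n; exact: tp_ge0.
have p0_le1 : p0 i <= 1.
  have c1 : (fun _ : nat => 1 : R) n @[n --> \oo] --> (1 : R) by exact: cvg_cst.
  apply: (ler_cvg_to (cvg_at_right_seq (hC i) hu1 uc1) c1).
  by apply: nearW => n; exact/ltW/pii_lt1.
have hF0 l : l \in Yset Q i -> on_half_line (F0 l) by move=> /hD1[].
have F0oo l : (F0 l setT < +oo)%E.
  by apply: (@le_lt_trans _ _ 1%E); [exact: probability_le1|exact: ltry].
have tm1 := @total_mass_probability R.
split => [j jY ji|tF0 htF0 j jD].
  rewrite /is_tF0 /tilde_laplace; have [iY|iY] /= := boolP (i \in Yset Q i); last first.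
    by exists (F0 j); split => //; exact: hF0.
  have [p1|p1] := ltP (p0 i) 1.
    by apply: geometric_sum_exists; rewrite ?p0_ge0//; exact: hF0.
  apply: exponential_exists; rewrite fine_gt0// hE2// andbT.
  by apply: mean_gt0; [exact: hF0|rewrite tm1; have [] := hD1 _ iY].
have ji : j != i by rewrite -notinD.
have [jY|jY] := boolP (j \in Yset Q i); last first.
  have hit0 e t : 0 < e <= 1 -> hit_df (P e) (eta e) (kappa e) D i j t = 0.
    move=> he; rewrite (hit_df_renewal (hMRP _ he) hDi (hinit _ he))//.
    rewrite /dist_fun (_ : renewal _ _ _ = 0%E)//.
    apply/eqP; rewrite eq_le measure_ge0 andbT.
    set r := renewal _ _.
    have -> : (0 = r setT)%E.
      rewrite /r renewal_setT; [|exact: hQ|exact: hQ|exact: pii_lt1].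
      by rewrite -[total_mass _]/(trans_prob (Q e) i j) zeroY// mul0r.
    by apply: le_measure; rewrite ?inE.
  have near01 : \forall e \near (0 : R)^'+, 0 < e <= 1.
    near=> e; apply/andP; split; near: e; [exact: nbhs_right_gt|exact: nbhs_right_le].
  split => [t _|].
    apply: cvg_at_right01 => u hu _.
    by under eq_fun do rewrite hit0//; exact: cvg_cst.
  rewrite (@cvg_lim _ _ _ _ _ _ 0) //; last exact: cvg_cst.
  apply: cvg_at_right01 => u hu _.
  rewrite (_ : (fun n => _) = cst 0); first exact: cvg_cst.
  apply/funext => n; apply/cvg_lim => //.
  by under eq_fun do rewrite hit0//; exact: cvg_cst.
have [htF hLtF] := htF0 _ jY ji.
(* The proof [he] is an argument because the kernels are known to be finite only for e in ]0, 1]. *)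
pose H e he := renewal (kernel_measure (hMRP e he) i j) (kernel_measure (hMRP e he) i i).
have hitE e he t : hit_df (P e) (eta e) (kappa e) D i j t = dist_fun (H e he) t.
  by rewrite (hit_df_renewal (hMRP _ he) hDi (hinit _ he)).
have HT e he : H e he setT = (tilde_trans_prob (Q e) i j)%:E.
  rewrite /H renewal_setT; [|exact: hQ|exact: hQ|exact: pii_lt1].
  by rewrite /tilde_trans_prob ji mul1r.
have Hoo e he : (H e he setT < +oo)%E by rewrite HT ltry.
have hH e he : on_half_line (H e he) by apply: renewal_half_line; exact: hQ.
have tv0 e : 0 < e <= 1 -> 0 < tv e.
  move=> he; rewrite /tv mulr_gt0 ?invr_gt0 ?subr_gt0 ?pii_lt1//.
  by rewrite (lt_le_trans _ (hv _ he)).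
have tp0_ge0 : 0 <= tp0 j by have /andP[] := htp0 j.
pose mu0 : {measure set (measurableTypeR R) -> \bar R} := mscale (NngNum tp0_ge0) (tF0 j).
have hmu0 : on_half_line mu0 by exact: mscale_half_line.
have tF0oo : (tF0 j setT < +oo)%E.
  by apply: (@le_lt_trans _ _ 1%E); [exact: probability_le1|exact: ltry].
have dist0 t : dist_fun mu0 t = dist_fun (tF0 j) t * tp0 j.
  rewrite /dist_fun -[X in fine X]/(_ * _)%E /= fineM ?fin_num_measure//=.
  by rewrite mulrC.
have G0E : (fun t => dist_fun (tF0 j) t * tp0 j) = dist_fun mu0.
  by apply/funext => t; rewrite dist0.
have mu0T : mu0 setT = (tp0 j)%:E.
  by rewrite -[LHS]/(_ * _)%E /= (_ : tF0 j _ = 1%E) ?mule1//; exact: probability_setT.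
have mu0oo : (mu0 setT < +oo)%E by rewrite mu0T ltry.
have Llim s : 0 <= s -> laplace mu0 s = tp0 j * tilde_laplace i (Yset Q i) p0 F0 j s.
  move=> s0; rewrite -hLtF// laplaceE elaplace_mscale fineM//.
  exact: elaplace_fin.
(* The total mass of the hitting law is exactly tilde p_{e,ij}, so convergence of masses is the
   assumption on these probabilities. *)
rewrite G0E; split; last first.
  rewrite (cvg_lim _ (dist_fun_cvg_total_mass mu0oo))//.
  rewrite /total_mass mu0T /=; apply: cvg_at_right01 => u hu uc.
  have := cvg_at_right_seq (htC j) hu uc; apply: cvg_trans.
  apply: near_eq_cvg; apply: nearW => n /=; apply/esym/cvg_lim => //.
  under eq_fun do rewrite (hitE _ (hu n)).
  have -> : tilde_trans_prob (Q (u n)) i j = total_mass (H _ (hu n)).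
    by rewrite /total_mass HT.
  exact: dist_fun_cvg_total_mass.
move=> t ct; apply: cvg_at_right01 => u hu uc.
pose mu_ n := scaled (H _ (hu n)) (tv (u n))^-1.
under eq_fun do rewrite (hitE _ (hu _)) -dist_fun_scaled ?tv0//.
apply: (@laplace_continuity R mu_ mu0) => //.
- by move=> n; apply: scaled_half_line; rewrite ?invr_gt0 ?tv0.
- by move=> n; rewrite scaled_setT.
move=> s s0; rewrite Llim//.
pose nu l n := scaled (cond_sojourn (Q (u n)) i l) (v (u n))^-1.
have v0' n : 0 < v (u n) by rewrite (lt_le_trans _ (hv _ (hu n))).
have nuT l n : l \in Yset Q i -> nu l n setT = 1%E.
  by move=> lY; rewrite scaled_setT; apply: normalized_setT; [exact: Qoo|exact: posY].
have nuoo l n : l \in Yset Q i -> (nu l n setT < +oo)%E by move=> lY; rewrite nuT// ltry.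
have hnu l n : on_half_line (nu l n).
  by apply: scaled_half_line; [rewrite invr_gt0|apply: normalized_half_line; exact: hQ].
have mnuE l n : l \in Yset Q i -> (mean (nu l n) < +oo)%E /\
    fine (mean (nu l n)) = fine (mean (cond_sojourn (Q (u n)) i l)) / v (u n).
  move=> lY; have mc := hE1 _ lY _ (hu n).
  have mc0 : (0 <= mean (cond_sojourn (Q (u n)) i l))%E.
    by apply: integral_ge0 => x /=; rewrite in_itv/= andbT lee_fin.
  have mcf : mean (cond_sojourn (Q (u n)) i l) \is a fin_num by rewrite ge0_fin_numE.
  rewrite mean_scaled ?invr_gt0//; split; first by rewrite lte_mul_pinfty ?lee_fin ?invr_ge0 ?ltW.
  by rewrite fineM//= mulrC.
have mnu l n : l \in Yset Q i -> (mean (nu l n) < +oo)%E by move=> lY; have [] := mnuE l n lY.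
have tail_cvg l (x_ : nat -> R) (x : R) : l \in Yset Q i -> (forall n, 0 <= x_ n) ->
    x_ n @[n --> \oo] --> x ->
    integrated_tail (nu l n) (x_ n) @[n --> \oo] --> integrated_tail (F0 l) x.
  move=> lY x_0 xx; have [[wc _] _ _] := hD1 _ lY.
  apply: integrated_tail_cvg => //.
  - by move=> n; exact: nuT.
  - exact: hF0.
  - by move=> n; exact: mnu.
  - exact: hE2.
  - move=> r cr; under eq_fun do rewrite dist_fun_scaled//.
    exact: (cvg_at_right_seq (wc r cr) hu uc).
  - have := cvg_at_right_seq (hE3 _ lY) hu uc; apply: cvg_trans.
    by apply: near_eq_cvg; apply: nearW => n /=; have [_ ->] := mnuE l n lY.
have laplace_nu l n x : l \in Yset Q i -> 0 <= x ->
    laplace (nu l n) x = 1 - x * integrated_tail (nu l n) x.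
  move=> lY x0; rewrite laplace_integrated_tail//; [|exact: nuoo|exact: mnu].
  by rewrite laplace0// /total_mass nuT//=; ring.
have laplace_F0 l x : l \in Yset Q i -> 0 <= x ->
    laplace (F0 l) x = 1 - x * integrated_tail (F0 l) x.
  move=> lY x0; rewrite (laplace_integrated_tail (F0oo l) (hF0 _ lY) (hE2 _ lY) x0).
  by rewrite laplace0 ?tm1; [ring|exact: hF0].
pose p n := trans_prob (Q (u n)) i i.
have p1 n : p n < 1 by exact: pii_lt1.
have pc : p n @[n --> \oo] --> p0 i by exact: cvg_at_right_seq (hC i) hu uc.
pose x_ n := (1 - p n) * s.
have x_0 n : 0 <= x_ n by rewrite mulr_ge0// subr_ge0 ltW.
have xc : x_ n @[n --> \oo] --> (1 - p0 i) * s.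
  by apply: cvgM; [apply: cvgB => //; exact: cvg_cst|exact: cvg_cst].
have x0 : 0 <= (1 - p0 i) * s by rewrite mulr_ge0// subr_ge0.
(* Without a loop at i there is no conditional law to integrate; 0 is a harmless value, since [K n]
   occurs only multiplied by [p n], which is then 0. *)
pose K n := if i \in Yset Q i then integrated_tail (nu i n) (x_ n) else 0.
pose K0 := if i \in Yset Q i then integrated_tail (F0 i) ((1 - p0 i) * s) else 0.
have K_ge0 n : 0 <= K n by rewrite /K; case: ifP => // _; exact: integrated_tail_ge0.
have K0_ge0 : 0 <= K0 by rewrite /K0; case: ifP => // _; exact: integrated_tail_ge0.
have Kc : K n @[n --> \oo] --> K0.
  by rewrite /K /K0; case: ifPn => iY; [exact: tail_cvg|exact: cvg_cst].
have muE n : laplace (mu_ n) s =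
    tilde_trans_prob (Q (u n)) i j * (1 - x_ n * integrated_tail (nu j n) (x_ n)) /
    (1 + p n * s * K n).
  rewrite -laplace_nu// /tilde_trans_prob ji mul1r.
  apply: (laplace_scaled_renewal (kernel_lty (hMRP _ (hu n)) i j)
    (kernel_lty (hMRP _ (hu n)) i i) (hQ _ (hu n) i j) (hQ _ (hu n) i i)
    (pii_lt1 _ (hu n)) (v0' n) s0 (K_ge0 n)).
  rewrite -/(trans_prob (Q (u n)) i i) -/(p n) -/(x_ n) /K.
  (* For i outside Y the normalised kernel is the zero measure, and the identity holds only through
     the factor p = 0. *)
  have [iY|iY] := boolP (i \in Yset Q i); first by rewrite -laplace_nu.
  by rewrite /p zeroY// !mul0r.
have den0 : 0 < 1 + p0 i * s * K0 by rewrite ltr_wpDr// !mulr_ge0.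
(* The three branches of [tilde_laplace] are matched with the single limit expression; its
   denominator is at least 1, so passing to the limit is legitimate. *)
have -> : tp0 j * tilde_laplace i (Yset Q i) p0 F0 j s =
    tp0 j * (1 - (1 - p0 i) * s * integrated_tail (F0 j) ((1 - p0 i) * s)) /
    (1 + p0 i * s * K0).
  rewrite -mulrA; congr (_ * _); rewrite -laplace_F0// /tilde_laplace.
  move: den0; rewrite /K0; have [iY|iY] /= := boolP (i \in Yset Q i) => den0; last first.
    have -> : p0 i = 0.
      have c0 : (fun _ : nat => 0 : R) n @[n --> \oo] --> (0 : R) by exact: cvg_cst.
      apply/eqP; rewrite eq_le p0_ge0 andbT; apply: (ler_cvg_to pc c0).
      by apply: nearW => n; rewrite /p zeroY.
    by rewrite subr0 mul1r mulr0 addr0 divr1.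
  have [p01|p01] := ltP (p0 i) 1.
    rewrite [laplace (F0 i) _]laplace_F0//; move: den0.
    move: (laplace _ _) (integrated_tail _ _) => L T den0.
    have d0 : 0 < 1 - p0 i by rewrite subr_gt0.
    have -> : 1 - p0 i * (1 - (1 - p0 i) * s * T) = (1 - p0 i) * (1 + p0 i * s * T) by ring.
    by field; rewrite !gt_eqF.
  (* The argument (1 - p) s is now 0: K becomes the mean of [F0 i] and the transform of [F0 j]
     becomes 1, which leaves the exponential transform. *)
  have -> : p0 i = 1 by apply/eqP; rewrite eq_le p0_le1 p01.
  rewrite subrr mul0r integrated_tail0; [|exact: F0oo|exact: hF0].
  by rewrite laplace0 ?tm1; [rewrite !mul1r mulrC|exact: hF0].
under eq_fun do rewrite muE.
apply: cvgM.
  apply: cvgM; first exact: cvg_at_right_seq (htC j) hu uc.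
  apply: cvgB; first exact: cvg_cst.
  by apply: cvgM => //; exact: tail_cvg.
apply: cvgV; first by rewrite gt_eqF.
apply: cvgD; first exact: cvg_cst.
by apply: cvgM => //; apply: cvgM => //; exact: cvg_cst.
Unshelve. all: by end_near. Qed.
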